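(* Let $(\mathbf X_1,\mathbf Y_1,\mathbf Z_1),\dots,(\mathbf X_n,\mathbf Y_n,\mathbf Z_n)$ be i.i.d. observations from a distribution $\mathrm P$ such that $\mathbf X$ and $\mathbf Y$ are not conditionally independent given $\mathbf Z$, and suppose that the conditional distribution of $\mathbf X$ given $\mathbf Z$ is known. Then, for any level $\alpha\in(0,1)$, the power of the conditional test based on $p_n$ (which rejects when $p_n<\alpha$) converges to one as $n\to\infty$.
   Context: $\mathrm P$ is a fixed distribution on $\mathbb R^d$, $d=d_X+d_Y+d_Z$. Fix $\sigma^2>0$ and let $K(\mathbf x,\mathbf y)=\exp\{-\sigma^2\|\mathbf x-\mathbf y\|^2/2\}$. Given the sample, the $\mathbf X_i'$ are drawn independently with $\mathbf X_i'\sim\mathrm P_{\mathbf X\mid\mathbf Z_i}$, where $\mathrm P_{\mathbf X\mid\mathbf Z}$ is the (known) conditional distribution (so $\mathbf X_i'$ is conditionally independent of $(\mathbf X_i,\mathbf Y_i)$ given $\mathbf Z_i$). With $\mathbf V_i=(\mathbf X_i,\mathbf Y_i,\mathbf Z_i)$ and $\mathbf V_i'=(\mathbf X_i',\mathbf Y_i,\mathbf Z_i)$, $$\hat\zeta_{n,\sigma}=\binom n2^{-1}\sum_{1\le i<j\le n}\big\{K(\mathbf V_i,\mathbf V_j)+K(\mathbf V_i',\mathbf V_j')-K(\mathbf V_i,\mathbf V_j')-K(\mathbf V_i',\mathbf V_j)\big\}.$$ For $\pi\in\{0,1\}^n$, $\hat\zeta_{n,\sigma}(\pi)$ is the same statistic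 computed with $(\mathbf X_i,\mathbf X_i')$ replaced by $(\mathbf U_i,\mathbf U_i')$, where $\mathbf U_i=\pi(i)\mathbf X_i+(1-\pi(i))\mathbf X_i'$ and $\mathbf U_i'=(1-\pi(i))\mathbf X_i+\pi(i)\mathbf X_i'$. The conditional $p$-value is $$p_n=\frac1{2^n}\sum_{\pi\in\{0,1\}^n}\mathrm I\big[\hat\zeta_{n,\sigma}(\pi)\ge\hat\zeta_{n,\sigma}\big].$$ *)

(* Defs.v *)
From HB Require Import structures.
From mathcomp Require Import all_boot all_order all_algebra.
From mathcomp Require Import all_classical all_reals all_analysis.
From mathcomp Require Import measurable_realfun.

Set Implicit Arguments.
Unset Strict Implicit.
Unset Printing Implicit Defensive.
Import Order.TTheory GRing.Theory Num.Theory.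
Import numFieldNormedType.Exports.

Local Open Scope classical_set_scope.
Local Open Scope ring_scope.

(* Points of R^m are m.-tuple R: unlike 'rV[R]_m, this type carries the product
   Borel sigma-algebra in the library. A triple (x, y, z) is parsed as
   ((x, y), z). *)
Notation obs R dX dY dZ := (dX.-tuple R * dY.-tuple R * dZ.-tuple R)%type.

Definition xpart (R : Type) (dX dY dZ : nat) (v : obs R dX dY dZ) :
  dX.-tuple R := v.1.1.
Definition ypart (R : Type) (dX dY dZ : nat) (v : obs R dX dY dZ) :
  dY.-tuple R := v.1.2.
Definition zpart (R : Type) (dX dY dZ : nat) (v : obs R dX dY dZ) :
  dZ.-tuple R := v.2.

Section conditional_probability.
Local Open Scope ereal_scope.

Definition generated_sigma (T : Type) d (S : measurableType d) (f : T -> S) :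
  set (set T) := preimage_set_system setT f measurable.

(* f is a version of the conditional probability of the event A given the
   sub-sigma-algebra F. *)
Definition is_cond_prob d (T : measurableType d) (R : realType)
    (P : probability T R) (F : set (set T)) (A : set T) (f : T -> \bar R) :
    Prop :=
  [/\ P.-integrable setT f,
      forall B : set (\bar R), measurable B -> F (f @^-1` B) &
      forall C : set T, F C -> P (A `&` C) = \int[P]_(t in C) f t].

(* Versions of a conditional probability exist (Radon-Nikodym) and are almost
   surely equal, so it does not matter which ones are used. *)
Definition cond_indep d (T : measurableType d) (R : realType)
    (P : probability T R)
    dA (SA : measurableType dA) (X : T -> SA)
    dB (SB : measurableType dB) (Y : T -> SB)
    dC (SC : measurableType dC) (Z : T -> SC) : Prop :=
  forall (A : set SA) (B : set SB) (f g h : T -> \bar R),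
    measurable A -> measurable B ->
    is_cond_prob P (generated_sigma Z) (X @^-1` A) f ->
    is_cond_prob P (generated_sigma Z) (Y @^-1` B) g ->
    is_cond_prob P (generated_sigma Z) (X @^-1` A `&` Y @^-1` B) h ->
    {ae P, forall t, h t = f t * g t}.

(* kappa is a regular conditional distribution of X given Z under P. *)
Definition is_cond_dist d (T : measurableType d) (R : realType)
    (P : probability T R)
    dA (SA : measurableType dA) (X : T -> SA)
    dC (SC : measurableType dC) (Z : T -> SC)
    (kappa : R.-pker SC ~> SA) : Prop :=
  forall A : set SA, measurable A ->
    is_cond_prob P (generated_sigma Z) (X @^-1` A) (fun t => kappa (Z t) A).

Definition mutually_independent d (T : measurableType d) (R : realType)
    (P : probability T R) d' (S : measurableType d') (n : nat)
    (V : 'I_n -> {RV P >-> S}) : Prop :=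
  forall (J : {set 'I_n}) (E : 'I_n -> set S), (forall i, measurable (E i)) ->
    P (\bigcap_(i in [set i | i \in J]) (V i @^-1` E i)) =
    \prod_(i in J) P (V i @^-1` E i).

Definition iid d (T : measurableType d) (R : realType)
    (P : probability T R) d' (S : measurableType d') (Q : probability S R)
    (n : nat) (V : 'I_n -> {RV P >-> S}) : Prop :=
  mutually_independent V /\
  forall i (E : set S), measurable E -> distribution P (V i) E = Q E.

(* Conditionally on the sample V_1, ..., V_n, the X'_i are independent and X'_i
   has distribution kappa (Z_i). *)
Definition drawn_given_sample d (T : measurableType d) (R : realType)
    (P : probability T R) (dX dY dZ : nat)
    (kappa : R.-pker (dZ.-tuple R) ~> (dX.-tuple R)) (n : nat)
    (V : 'I_n -> {RV P >-> obs R dX dY dZ})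
    (X' : 'I_n -> {RV P >-> dX.-tuple R}) : Prop :=
  forall A : 'I_n -> set (dX.-tuple R), (forall i, measurable (A i)) ->
    is_cond_prob P (g_sigma_preimage (fun i => V i : T -> obs R dX dY dZ))
      (\bigcap_i (X' i @^-1` A i))
      (fun t => \prod_(i < n) kappa (zpart (V i t)) (A i)).

End conditional_probability.

Section statistic.
Variable R : realType.

Definition sq_enorm_dist (m : nat) (x y : m.-tuple R) : R :=
  \sum_(k < m) (tnth x k - tnth y k) ^+ 2.

Definition gauss_kernel (sigma : R) (m : nat) (x y : m.-tuple R) : R :=
  expR (- (sigma ^+ 2 * sq_enorm_dist x y / 2)).

Variables dX dY dZ : nat.

Definition obs_vector (x : dX.-tuple R) (y : dY.-tuple R) (z : dZ.-tuple R) :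
  (dX + dY + dZ).-tuple R := [tuple of (x ++ y) ++ z].

Definition zeta_hat (sigma : R) (n : nat)
    (X X' : 'I_n -> dX.-tuple R) (Y : 'I_n -> dY.-tuple R)
    (Z : 'I_n -> dZ.-tuple R) : R :=
  let K := @gauss_kernel sigma (dX + dY + dZ) in
  let V i := obs_vector (X i) (Y i) (Z i) in
  let V' i := obs_vector (X' i) (Y i) (Z i) in
  'C(n, 2)%:R^-1 *
  \sum_(i < n) \sum_(j < n | (i < j)%N)
    (K (V i) (V j) + K (V' i) (V' j) - K (V i) (V' j) - K (V' i) (V j)).

Definition swap (b : bool) (x x' : dX.-tuple R) : dX.-tuple R :=
  [tuple b%:R * tnth x k + (1 - b%:R) * tnth x' k | k < dX].

Definition zeta_hat_swap (sigma : R) (n : nat) (pi : {ffun 'I_n -> bool})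
    (X X' : 'I_n -> dX.-tuple R) (Y : 'I_n -> dY.-tuple R)
    (Z : 'I_n -> dZ.-tuple R) : R :=
  zeta_hat sigma (fun i => swap (pi i) (X i) (X' i))
    (fun i => swap (~~ pi i) (X i) (X' i)) Y Z.

Definition p_value (sigma : R) (n : nat)
    (X X' : 'I_n -> dX.-tuple R) (Y : 'I_n -> dY.-tuple R)
    (Z : 'I_n -> dZ.-tuple R) : R :=
  (2 ^+ n)^-1 *
  \sum_(pi : {ffun 'I_n -> bool})
    (zeta_hat sigma X X' Y Z <= zeta_hat_swap sigma pi X X' Y Z)%R%:R.

End statistic.

Definition power d (T : measurableType d) (R : realType)
    (P : probability T R) (dX dY dZ : nat) (sigma alpha : R) (n : nat)
    (V : 'I_n -> {RV P >-> obs R dX dY dZ})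
    (X' : 'I_n -> {RV P >-> dX.-tuple R}) : \bar R :=
  P [set t | p_value sigma (fun i => xpart (V i t)) (fun i => X' i t)
               (fun i => ypart (V i t)) (fun i => zpart (V i t)) < alpha].

(* Main.v *)
From HB Require Import structures.
Require Import Defs.
From mathcomp Require Import all_boot all_order all_algebra.
From mathcomp Require Import all_classical all_reals all_analysis.
From mathcomp Require Import measurable_realfun.
From mathcomp Require Import zify ring lra.

Set Implicit Arguments.
Unset Strict Implicit.
Unset Printing Implicit Defensive.
Import Order.TTheory GRing.Theory Num.Theory.
Import numFieldNormedType.Exports.

Local Open Scope classical_set_scope.
Local Open Scope ring_scope.

(** Expand the exponential in [K(x, y) = e(x) e(y) exp(sigma^2 <x, y>)], where
    [e(x) = exp(- sigma^2 |x|^2 / 2)], and the inner product powers into words: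
    up to positive weights, [K] is the inner product of the features
    [g_w(x) = e(x) x_(w_1) ... x_(w_k)], indexed by all the words [w] in the
    coordinates.

    Up to the diagonal terms, the sum of the pair kernel over all pairs is the
    squared norm of the sum of the vectors [g(V_i) - g(V'_i)], so it is bounded
    below by one weighted square [c_w (sum_i (g_w(V_i) - g_w(V'_i)))^2]
    (lemma [pair_kernel_sum_ge]). If the mean [m] of [g_w(V) - g_w(V')] is not
    zero for some [w], then Chebyshev's inequality ([resampled_sum_tail]) makes
    this of order [n^2] with probability tending to one.

    On the other hand a swap multiplies the pair kernel of [i] and [j] by two
    independent random signs. Conditionally on the data, the swapped sum is a
    Rademacher chaos, whose second moment is a sum of at most [n^2] bounded
    terms. Markov's inequality then bounds the p-value by [4 n^2 / S^2], where
    [S] is the unswapped sum ([p_value_le]). This is [O(n^-2)] once [S] is of order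
    [n^2], hence below [alpha] ([p_value_lt]).

    It remains to find a word with [m <> 0] ([exists_separating_word]). The
    [g_w] determine finite measures ([measure_eq_damped_monomials]): they are
    bounded, and the least class that contains them and is closed under linear
    combinations and bounded pointwise limits is an algebra that contains every
    Borel indicator. Hence, if all the means vanished, [V] and [V'] would have
    the same law, so that the kernel would describe [X] given [Y] and [Z]
    together, and [X] and [Y] would be conditionally independent given [Z]
    ([cond_indep_of_kernel]). *)

(** * Feature expansion of the Gaussian kernel *)

Lemma cvg_finite_sum (R : realType) (I : finType) (u : I -> nat -> R)
    (l : I -> R) : (forall i, u i n @[n --> \oo] --> l i) ->
  \sum_i u i n @[n --> \oo] --> \sum_i l i.
Proof.
move=> ul; elim: (index_enum I) => [|i s IHs].
  by under eq_fun do rewrite big_nil; rewrite big_nil; exact: cvg_cst.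
by under eq_fun do rewrite big_cons; rewrite big_cons; exact: cvgD.
Qed.

Definition sq_enorm (R : realType) (m : nat) (x : m.-tuple R) : R :=
  \sum_(l < m) tnth x l ^+ 2.

(** Words instead of multi-indices: the powers of an inner product expand over
    them without multinomial coefficients. *)
Definition word_monomial (R : realType) (m k : nat) (w : {ffun 'I_k -> 'I_m})
    (x : m.-tuple R) : R :=
  \prod_(i < k) tnth x (w i).

Definition damped_monomial (R : realType) (c : R) (m k : nat)
    (w : {ffun 'I_k -> 'I_m}) (x : m.-tuple R) : R :=
  expR (- (c * sq_enorm x)) * word_monomial w x.

Section gaussian_kernel.
Context (R : realType) (sigma : R) (m : nat).
Implicit Types x y : m.-tuple R.
Let c := sigma ^+ 2 / 2.

Lemma inner_product_expE k x y :
  (\sum_(l < m) tnth x l * tnth y l) ^+ k =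
  \sum_(w : {ffun 'I_k -> 'I_m}) word_monomial w x * word_monomial w y.
Proof.
have -> : (\sum_(l < m) tnth x l * tnth y l) ^+ k =
    \prod_(i < k) \sum_(l < m) tnth x l * tnth y l.
  by rewrite prodr_const card_ord.
by rewrite bigA_distr_bigA/=; apply: eq_bigr => w _; rewrite big_split.
Qed.

Lemma gauss_kernelE x y :
  gauss_kernel sigma x y = expR (- (c * sq_enorm x)) *
    expR (- (c * sq_enorm y)) *
    expR (sigma ^+ 2 * \sum_(l < m) tnth x l * tnth y l).
Proof.
rewrite /gauss_kernel -!expRD; congr expR.
have -> : sq_enorm_dist x y = sq_enorm x + sq_enorm y -
    2 * \sum_(l < m) tnth x l * tnth y l.
  rewrite /sq_enorm_dist /sq_enorm mulr_sumr -big_split -sumrB/=.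
  by apply: eq_bigr => l _; ring.
by rewrite /c; field.
Qed.

Lemma gauss_kernel_ge0 x y : 0 <= gauss_kernel sigma x y.
Proof. exact: expR_ge0. Qed.

Lemma gauss_kernel_le1 x y : gauss_kernel sigma x y <= 1.
Proof.
rewrite /gauss_kernel -expR0 ler_expR oppr_le0 divr_ge0// mulr_ge0 ?sqr_ge0//.
by apply: sumr_ge0 => l _; exact: sqr_ge0.
Qed.

Lemma gauss_kernelxx x : gauss_kernel sigma x x = 1.
Proof.
rewrite /gauss_kernel /sq_enorm_dist big1 ?mulr0 ?mul0r ?oppr0 ?expR0// => l _.
by rewrite subrr expr0n.
Qed.

Lemma gauss_kernelC x y : gauss_kernel sigma x y = gauss_kernel sigma y x.
Proof.
rewrite /gauss_kernel (_ : sq_enorm_dist x y = sq_enorm_dist y x)//.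
by rewrite /sq_enorm_dist; apply: eq_bigr => l _; ring.
Qed.

(** Expanding [exp (sigma^2 <x, y>)] into words turns the quadratic form of
    the kernel into a series of squares, any one of which is a lower bound. *)
Lemma gauss_kernel_quadratic_ge (I : finType) (a : I -> R)
    (x : I -> m.-tuple R) k (w : {ffun 'I_k -> 'I_m}) :
  (sigma ^+ 2) ^+ k / k`!%:R * (\sum_i a i * damped_monomial c w (x i)) ^+ 2 <=
  \sum_i \sum_j a i * a j * gauss_kernel sigma (x i) (x j).
Proof.
pose e i := a i * expR (- (c * sq_enorm (x i))).
pose dot i j := \sum_(l < m) tnth (x i) l * tnth (x j) l.
pose u N := \sum_i \sum_j e i * e j * series (exp_coeff (sigma ^+ 2 * dot i j)) N.
have uE N : u N = \sum_(0 <= q < N) (sigma ^+ 2) ^+ q / q`!%:R *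
    \sum_(v : {ffun 'I_q -> 'I_m}) (\sum_i e i * word_monomial v (x i)) ^+ 2.
  rewrite /u /series/=.
  under eq_bigr => i _ do under eq_bigr => j _ do rewrite mulr_sumr.
  under eq_bigr => i _ do rewrite exchange_big/=.
  rewrite exchange_big/=; apply: eq_bigr => q _.
  rewrite mulr_sumr.
  under [RHS]eq_bigr => v _ do rewrite (expr2 (\sum_i _)) big_distrlr/= mulr_sumr.
  rewrite [RHS]exchange_big/=; apply: eq_bigr => i _.
  under [RHS]eq_bigr => v _ do rewrite mulr_sumr.
  rewrite [RHS]exchange_big/=; apply: eq_bigr => j _.
  rewrite /exp_coeff/= exprMn /dot inner_product_expE.
  rewrite !(mulr_sumr,mulr_suml); apply: eq_bigr => v _.
  by ring.
(* The partial sums of the exponential series give sums of squares; they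
   converge to the quadratic form of the kernel. *)
have cu : u N @[N --> \oo] -->
    \sum_i \sum_j a i * a j * gauss_kernel sigma (x i) (x j).
  rewrite (_ : \sum_i _ = \sum_i \sum_j e i * e j * expR (sigma ^+ 2 * dot i j)).
    rewrite /u; apply: cvg_finite_sum => i; apply: cvg_finite_sum => j.
    apply: cvgM; first exact: cvg_cst.
    exact: is_cvg_series_exp_coeff.
  apply: eq_bigr => i _; apply: eq_bigr => j _.
  by rewrite gauss_kernelE /e /dot; ring.
rewrite -(cvg_lim _ cu)//; apply: limr_ge; first by apply: cvgP cu.
exists k.+1 => // N /= kN; rewrite uE (bigD1_seq k)/= ?iota_uniq//; last first.
  by rewrite mem_index_iota.
have nn q (v : {ffun 'I_q -> 'I_m} -> R) : (forall f, 0 <= v f) ->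
    0 <= (sigma ^+ 2) ^+ q / q`!%:R * \sum_f v f.
  move=> v0; rewrite mulr_ge0// ?sumr_ge0// divr_ge0//.
  by rewrite exprn_ge0// sqr_ge0.
rewrite -[leLHS]addr0 lerD//; last first.
  by apply: sumr_ge0 => q _; apply: nn => v; exact: sqr_ge0.
apply: ler_wpM2l; first by rewrite divr_ge0// exprn_ge0// sqr_ge0.
rewrite (bigD1 w)//= -[leLHS]addr0; apply: lerD; last first.
  by apply: sumr_ge0 => v _; exact: sqr_ge0.
rewrite le_eqVlt; apply/orP; left; apply/eqP; congr (_ ^+ 2).
by apply: eq_bigr => i _; rewrite /e /damped_monomial mulrA.
Qed.

End gaussian_kernel.

(** * Random swaps and the p-value *)

Section random_signs.
Context (R : realType) (n : nat).
Implicit Types (pi : {ffun 'I_n -> bool}) (h : 'I_n -> 'I_n -> R).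

Definition swap_sign pi (i : 'I_n) : R := if pi i then 1 else -1.

Lemma swap_sign_sqr pi i : swap_sign pi i ^+ 2 = 1.
Proof. by rewrite /swap_sign; case: (pi i); rewrite ?sqrrN expr1n. Qed.

(** Flipping the swap at an index that occurs in exactly one of the two pairs
    reverses the sign of the product, so the average over all swaps vanishes. *)
Lemma swap_sign_orthogonal (p q : 'I_n * 'I_n) : (p.1 < p.2)%N ->
  (q.1 < q.2)%N -> p != q ->
  \sum_pi swap_sign pi p.1 * swap_sign pi p.2 *
    (swap_sign pi q.1 * swap_sign pi q.2) = 0.
Proof.
case: p q => p1 p2 [q1 q2] /= p12 q12 pq.
have p12' : p1 != p2 by rewrite -val_eqE neq_ltn p12.
have q12' : q1 != q2 by rewrite -val_eqE neq_ltn q12.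
have [a Ha] : exists a, [|| (p1 == a) && [&& p2 != a, q1 != a & q2 != a]
    | (p2 == a) && [&& p1 != a, q1 != a & q2 != a]].
  have [p1q|] := boolP ((p1 == q1) || (p1 == q2)); last first.
    rewrite negb_or => /andP[p1q1 p1q2]; exists p1.
    by rewrite eqxx eq_sym p12' eq_sym p1q1 eq_sym p1q2.
  exists p2; rewrite eqxx p12'/=; apply/orP; right; apply/andP; split.
    apply/eqP => q1p2; move: p1q; rewrite q1p2 (negbTE p12')/= => /eqP p1q2.
    by move: q12; rewrite q1p2 -p1q2 ltnNge ltnW.
  apply/eqP => q2p2; move: p1q; rewrite q2p2 (negbTE p12') orbF => /eqP p1q1.
  by move: pq; rewrite q2p2 p1q1 eqxx.
pose flip pi : {ffun 'I_n -> bool} := [ffun i => (i == a) (+) pi i].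
have flipK : involutive flip.
  by move=> pi; apply/ffunP => i; rewrite !ffunE addbA addbb.
have signE pi i : swap_sign (flip pi) i =
    (if i == a then -1 else 1) * swap_sign pi i.
  by rewrite /swap_sign ffunE; case: (i == a); case: (pi i) => /=; ring.
set S := LHS; have SN : S = - S.
  rewrite {1}/S (reindex_inj (inv_inj flipK))/= -sumrN; apply: eq_bigr => pi _.
  rewrite !signE.
  by case/orP: Ha => /andP[-> /and3P[/negbTE-> /negbTE-> /negbTE->]]; ring.
lra.
Qed.

(** The signed sum is a Rademacher chaos of order two: its distinct monomials
    are orthogonal under the uniform choice of swaps. *)
Lemma rademacher_chaos_second_moment h :
  \sum_pi (\sum_(i < n) \sum_(j < n | (i < j)%N)
    swap_sign pi i * swap_sign pi j * h i j) ^+ 2 =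
  2 ^+ n * \sum_(i < n) \sum_(j < n | (i < j)%N) h i j ^+ 2.
Proof.
pose s pi (p : 'I_n * 'I_n) := swap_sign pi p.1 * swap_sign pi p.2.
pose hp (p : 'I_n * 'I_n) := h p.1 p.2.
pose lt (p : 'I_n * 'I_n) := (p.1 < p.2)%N.
transitivity (\sum_(p | lt p) \sum_(q | lt q)
    hp p * hp q * \sum_pi s pi p * s pi q).
  under eq_bigr => pi _ do rewrite pair_big_dep/= expr2 big_distrlr/=.
  rewrite exchange_big/=; apply: eq_bigr => p _.
  rewrite exchange_big/=; apply: eq_bigr => q _.
  by rewrite mulr_sumr; apply: eq_bigr => pi _; rewrite /s /hp; ring.
rewrite [in RHS]pair_big_dep/= mulr_sumr; apply: eq_bigr => p ltp.
rewrite (bigD1 p)//= [X in _ + X]big1 => [|q /andP[ltq qp]]; last first.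
  by rewrite swap_sign_orthogonal ?mulr0// eq_sym.
have -> : \sum_pi s pi p * s pi p = 2 ^+ n.
  transitivity (\sum_(pi : {ffun 'I_n -> bool}) (1 : R)).
    apply: eq_bigr => pi _; rewrite /s -expr2 exprMn.
    by rewrite !swap_sign_sqr mulr1.
  by rewrite sumr_const card_ffun card_bool card_ord -natrX.
by rewrite addr0 -expr2 mulrC.
Qed.

End random_signs.

Section statistic_bounds.
Context (R : realType) (dX dY dZ : nat) (sigma : R) (n : nat).
Variables (X X' : 'I_n -> dX.-tuple R) (Y : 'I_n -> dY.-tuple R)
  (Z : 'I_n -> dZ.-tuple R).
Let K := @gauss_kernel R sigma (dX + dY + dZ).
Let v i := obs_vector (X i) (Y i) (Z i).
Let v' i := obs_vector (X' i) (Y i) (Z i).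

Definition pair_kernel i j : R :=
  K (v i) (v j) + K (v' i) (v' j) - K (v i) (v' j) - K (v' i) (v j).

Definition pair_kernel_sum : R :=
  \sum_(i < n) \sum_(j < n | (i < j)%N) pair_kernel i j.

Lemma pair_kernel_sqr_le i j : pair_kernel i j ^+ 2 <= 4.
Proof.
have K01 x y : 0 <= K x y <= 1 by rewrite gauss_kernel_ge0 gauss_kernel_le1.
suff /andP[? ?] : -2 <= pair_kernel i j <= 2 by nra.
rewrite /pair_kernel.
have := K01 (v i) (v j); have := K01 (v' i) (v' j).
have := K01 (v i) (v' j); have := K01 (v' i) (v j).
move: (K _ _) (K _ _) (K _ _) (K _ _) => a b e f.
by lra.
Qed.

Lemma swapT (x x' : dX.-tuple R) : swap true x x' = x.
Proof.
by apply: eq_from_tnth => l; rewrite tnth_mktuple subrr mul1r mul0r addr0.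
Qed.

Lemma swapF (x x' : dX.-tuple R) : swap false x x' = x'.
Proof.
by apply: eq_from_tnth => l; rewrite tnth_mktuple subr0 mul1r mul0r add0r.
Qed.

Lemma zeta_hat_swapE (pi : {ffun 'I_n -> bool}) :
  zeta_hat_swap sigma pi X X' Y Z = 'C(n, 2)%:R^-1 *
  \sum_(i < n) \sum_(j < n | (i < j)%N)
    swap_sign R pi i * swap_sign R pi j * pair_kernel i j.
Proof.
congr (_ * _); apply: eq_bigr => i _; apply: eq_bigr => j _.
rewrite /swap_sign /pair_kernel /v /v' /K.
by case: (pi i); case: (pi j); rewrite /= ?swapT ?swapF; ring.
Qed.

(** Markov's inequality for the second moment under uniform swaps. *)
Lemma p_value_le : (1 < n)%N -> 0 < pair_kernel_sum ->
  p_value sigma X X' Y Z <= 4 * n%:R ^+ 2 / pair_kernel_sum ^+ 2.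
Proof.
move=> n1 S0; set S := pair_kernel_sum.
pose T (pi : {ffun 'I_n -> bool}) := \sum_(i < n) \sum_(j < n | (i < j)%N)
  swap_sign R pi i * swap_sign R pi j * pair_kernel i j.
have C0 : 0 < 'C(n, 2)%:R^-1 :> R by rewrite invr_gt0 ltr0n bin_gt0.
have p2 : 0 < 2 ^+ n :> R by rewrite exprn_gt0.
rewrite /p_value mulrC ler_pdivrMr//.
apply: (@le_trans _ _ (\sum_pi T pi ^+ 2 / S ^+ 2)).
  apply: ler_sum => pi _.
  have zE : zeta_hat sigma X X' Y Z = 'C(n, 2)%:R^-1 * S by [].
  rewrite zeta_hat_swapE zE (ler_pM2l C0) -/(T pi).
  case: (leP S (T pi)) => /= [ST|_]; last first.
    by apply: divr_ge0; exact: sqr_ge0.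
  rewrite ler_pdivlMr ?exprn_gt0// mul1r ler_sqr// ?nnegrE ltW//.
  exact: lt_le_trans ST.
rewrite -mulr_suml rademacher_chaos_second_moment [leRHS]mulrAC.
rewrite ler_pM2r ?invr_gt0 ?exprn_gt0// [leRHS]mulrC ler_pM2l//.
apply: (@le_trans _ _ (\sum_(i < n) \sum_(j < n) 4)).
  apply: ler_sum => i _; rewrite [leRHS](bigID (fun j : 'I_n => (i < j)%N))/=.
  rewrite -[leLHS]addr0 lerD ?sumr_ge0//; apply: ler_sum => j _.
  exact: pair_kernel_sqr_le.
by rewrite !sumr_const !card_ord -mulrnA -[leLHS]mulr_natr natrM expr2.
Qed.

(** The sum over all ordered pairs is the squared norm of the sum of the
    differences of feature vectors; the diagonal costs at most [2 n]. *)
Lemma pair_kernel_sum_ge k (w : {ffun 'I_k -> 'I_(dX + dY + dZ)}) g :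
  g = damped_monomial (sigma ^+ 2 / 2) w ->
  (sigma ^+ 2) ^+ k / k`!%:R * (\sum_(i < n) (g (v i) - g (v' i))) ^+ 2 <=
  2 * pair_kernel_sum + 2 * n%:R.
Proof.
move=> gE.
pose a (ib : 'I_n * bool) : R := if ib.2 then 1 else -1.
pose x (ib : 'I_n * bool) := if ib.2 then v ib.1 else v' ib.1.
have := gauss_kernel_quadratic_ge sigma a x w; rewrite -gE.
have sumb (F : 'I_n * bool -> R) :
    \sum_p F p = \sum_(i < n) (F (i, true) + F (i, false)).
  transitivity (\sum_(i < n) \sum_b F (i, b)).
    by rewrite pair_bigA/=; apply: eq_bigr => -[].
  by apply: eq_bigr => i _; rewrite big_bool.
rewrite sumb/= [X in _ <= X](_ : _ = \sum_i \sum_j pair_kernel i j); last first.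
  rewrite sumb; apply: eq_bigr => i _; rewrite !sumb -big_split/=.
  by apply: eq_bigr => j _; rewrite /a /x /pair_kernel /= /K; ring.
under eq_bigr do rewrite /a /x/= mul1r mulN1r.
move=> /le_trans; apply.
have sym i j : pair_kernel i j = pair_kernel j i.
  have KC : forall x y, K x y = K y x := @gauss_kernelC _ sigma _.
  rewrite /pair_kernel (KC (v j)) (KC (v' j) (v' i)).
  by rewrite (KC (v j) (v' i)) (KC (v' j)); ring.
have -> : \sum_i \sum_j pair_kernel i j =
    \sum_i pair_kernel i i + 2 * pair_kernel_sum.
  rewrite mulr_natl mulr2n {1}/pair_kernel_sum.
  rewrite [X in _ + (X + _)](_ : _ =
      \sum_(i < n) \sum_(j < n | (j < i)%N) pair_kernel i j).
    rewrite /pair_kernel_sum -!big_split/=; apply: eq_bigr => i _.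
    rewrite (bigD1 i)//=; congr (_ + _).
    rewrite (bigID (fun j : 'I_n => (j < i)%N))/=; congr (_ + _).
      by apply: eq_bigl => j; rewrite -val_eqE/=; lia.
    by apply: eq_bigl => j; rewrite -val_eqE/=; lia.
  rewrite (exchange_big_dep predT)//=; apply: eq_bigr => i _.
  by apply: eq_bigr => j _; exact: sym.
rewrite addrC lerD2l -[n in leRHS]card_ord mulr_natr -sumr_const.
apply: ler_sum => i _; rewrite /pair_kernel.
have := gauss_kernel_ge0 sigma (v i) (v' i).
have := gauss_kernel_ge0 sigma (v' i) (v i).
by rewrite /K !gauss_kernelxx; lra.
Qed.

End statistic_bounds.

(** * Closure under bounded pointwise limits *)

Section bounded_closure.
Context (R : realType) (T : Type).
Implicit Types (G : set (T -> R)) (f g : T -> R).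

(** The uniform bound in the limit rule is what dominated convergence needs, so
    identities between integrals pass to the closure by induction. *)
Inductive bounded_closure G : (T -> R) -> Prop :=
| bounded_closure_gen f : G f -> bounded_closure G f
| bounded_closureD f g : bounded_closure G f -> bounded_closure G g ->
    bounded_closure G (f \+ g)
| bounded_closureZ a f : bounded_closure G f ->
    bounded_closure G (fun x => a * f x)
| bounded_closure_lim (f_ : nat -> T -> R) f B :
    (forall n, bounded_closure G (f_ n)) -> (forall n x, `|f_ n x| <= B) ->
    (forall x, f_ n x @[n --> \oo] --> f x) -> bounded_closure G f.

Lemma cvg_normr_le (u : nat -> R) (l B : R) :
  (forall n, `|u n| <= B) -> u n @[n --> \oo] --> l -> `|l| <= B.
Proof.
move=> uB ul; have ul' : `|u n| @[n --> \oo] --> `|l| by exact: cvg_norm.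
rewrite -(cvg_lim _ ul')//; apply: limr_le; first by apply: cvgP ul'.
exact: nearW.
Qed.

Lemma bounded_closure_bounded G f :
  (forall g, G g -> exists B : R, forall x, `|g x| <= B) ->
  bounded_closure G f -> exists B : R, forall x, `|f x| <= B.
Proof.
move=> GB; elim=> {f} [f /GB//|f g _ [A fA] _ [B gB]|a f _ [B fB]|f_ f B _ _ fB ff].
- by exists (A + B) => x; rewrite (le_trans (ler_normD _ _))// lerD.
- by exists (`|a| * B) => x; rewrite normrM ler_wpM2l.
- by exists B => x; exact: cvg_normr_le (ff x).
Qed.

Section algebra.
Variable G : set (T -> R).
Hypothesis G_bounded : forall g, G g -> exists B : R, forall x, `|g x| <= B.
Local Notation L := (bounded_closure G).

(** Multiplication by a fixed bounded function commutes with every closure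
    operation, so products only have to be checked on generators. *)
Lemma bounded_closure_mul_gen g : (exists B : R, forall x, `|g x| <= B) ->
  (forall f, G f -> L (f \* g)) -> forall f, L f -> L (f \* g).
Proof.
move=> [B gB] Gg f; elim=> {f} [f /Gg//|f f' _ Lf _ Lf'|a f _ Lf|f_ f A _ Lf fA ff].
- rewrite (_ : _ \* g = (f \* g) \+ (f' \* g)); first exact: bounded_closureD.
  by apply/funext => x /=; rewrite mulrDl.
- rewrite (_ : _ \* g = (fun x => a * (f \* g) x)); first exact: bounded_closureZ.
  by apply/funext => x /=; rewrite mulrA.
- apply: (@bounded_closure_lim _ (fun n => f_ n \* g) _ (A * B)) => // [n x|x].
    by rewrite normrM ler_pM.
  by apply: cvgM => //; exact: cvg_cst.
Qed.

Hypothesis G_mul : forall f g, G f -> G g -> L (f \* g).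

Lemma bounded_closureM f g : L f -> L g -> L (f \* g).
Proof.
move=> Lf Lg; apply: bounded_closure_mul_gen => //.
  exact: bounded_closure_bounded Lg.
move=> f' Gf'; rewrite (_ : f' \* g = g \* f'); last first.
  by apply/funext => x /=; rewrite mulrC.
apply: bounded_closure_mul_gen => //; first exact: G_bounded.
by move=> g' Gg'; exact: G_mul.
Qed.

Lemma bounded_closure_ext f g : f =1 g -> L f -> L g.
Proof. by move=> /funext ->. Qed.

Lemma bounded_closureB f g : L f -> L g -> L (f \- g).
Proof.
move=> Lf Lg; apply: (@bounded_closure_ext (f \+ (fun x => -1 * g x))).
  by move=> x /=; rewrite mulN1r.
by apply: bounded_closureD => //; exact: bounded_closureZ.
Qed.

(** If [0 < u <= 1] then [1 - (1 - u)^n] is a polynomial in [u] without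
    constant term that increases to [1]. *)
Lemma bounded_closure1 u : L u -> (forall x, 0 < u x <= 1) -> L (cst 1).
Proof.
move=> Lu u01; have Lpow n : L (fun x => 1 - (1 - u x) ^+ n.+1).
  elim: n => [|n IHn].
    by apply: bounded_closure_ext Lu => x; rewrite expr1; ring.
  pose f x := 1 - (1 - u x) ^+ n.+1.
  apply: (@bounded_closure_ext ((f \+ u) \- (u \* f))).
    by move=> x; rewrite /f/= [(_ ^+ n.+2)]exprS; ring.
  apply: bounded_closureB; first exact: bounded_closureD.
  exact: bounded_closureM.
apply: (@bounded_closure_lim _ _ _ 1 Lpow) => [n x|x].
  have /andP[u0 u1] := u01 x.
  have p0 : 0 <= (1 - u x) ^+ n.+1 by apply: exprn_ge0; lra.
  have p1 : (1 - u x) ^+ n.+1 <= 1 by apply: exprn_ile1; lra.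
  by rewrite ler_norml; lra.
have /andP[u0 u1] := u01 x.
rewrite -[X in _ --> X]subr0; apply: cvgB; first exact: cvg_cst.
have /cvg_expr : `|1 - u x| < 1 by rewrite ltr_norml; lra.
by rewrite -cvg_shiftS.
Qed.

Hypothesis L1 : L (cst 1).

Lemma bounded_closureX f n : L f -> L (fun x => f x ^+ n).
Proof.
move=> Lf; elim: n => [|n IHn]; first exact: (bounded_closure_ext _ L1).
by apply: (@bounded_closure_ext _ _ _ (bounded_closureM Lf IHn)) => x; rewrite exprS.
Qed.

End algebra.

End bounded_closure.

Section sign_iteration.
Context (R : realType).

(** The Newton-Schulz iteration for the sign function: an odd polynomial
    that preserves [[-1, 1]] and has its attracting fixed points at [1] and [-1]. *)
Definition sign_step (t : R) : R := (3 * t - t ^+ 3) / 2.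

Lemma sign_step_norm_le1 t : `|t| <= 1 -> `|sign_step t| <= 1.
Proof.
rewrite !ler_norml => /andP[tN t1].
have h (s : R) : -1 <= s -> s <= 1 -> 0 <= (1 - s) ^+ 2 * (2 + s).
  by move=> ? ?; rewrite mulr_ge0 ?sqr_ge0//; lra.
have := h t tN t1; have := h (- t); rewrite /sign_step => /(_ _ _); lra.
Qed.

Lemma iter_sign_step_norm_le1 n t : `|t| <= 1 -> `|iter n sign_step t| <= 1.
Proof. by move=> t1; elim: n => //= n; exact: sign_step_norm_le1. Qed.

Lemma iter_sign_stepN n t : iter n sign_step (- t) = - iter n sign_step t.
Proof. by elim: n => //= n ->; rewrite /sign_step; field. Qed.

(** One has [1 - q v = (1 - v) (1 - (v + v^2) / 2)] for the step [q], and the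
    second factor is at most [1 - t / 2] once [v >= t]: the iterates of a
    positive [t] approach [1] geometrically. *)
Lemma cvg_iter_sign_step t : `|t| <= 1 ->
  iter n sign_step t @[n --> \oo] --> Num.sg t.
Proof.
have pos s : 0 < s <= 1 -> iter n sign_step s @[n --> \oo] --> (1 : R).
  move=> /andP[s0 s1].
  have bnd n : s <= iter n sign_step s <= 1 /\
      1 - iter n sign_step s <= (1 - s / 2) ^+ n.
    elim: n => [|n [/andP[sv v1] IHn]] /=.
      by rewrite lexx s1 expr0; split => //; lra.
    move: (iter n _ _) sv v1 IHn => v sv v1 IHn.
    split.
      have : 0 <= v * ((1 - v) * (1 + v)) by rewrite !mulr_ge0//; lra.
      have : 0 <= (1 - v) ^+ 2 * (2 + v) by rewrite mulr_ge0 ?sqr_ge0//; lra.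
      by rewrite /sign_step; lra.
    rewrite exprS; apply: (@le_trans _ _ ((1 - s / 2) * (1 - v))); last first.
      by rewrite ler_wpM2l//; lra.
    have -> : 1 - sign_step v = (1 - (v + v ^+ 2) / 2) * (1 - v).
      by rewrite /sign_step; field.
    by rewrite ler_wpM2r ?subr_ge0//; nra.
  apply: (@squeeze_cvgr _ _ _ _ (fun n => 1 - (1 - s / 2) ^+ n) (cst 1)).
  - by apply: nearW => n; have [/andP[_ ->] h] := bnd n; rewrite andbT; lra.
  - rewrite -[X in _ --> X]subr0; apply: cvgB; first exact: cvg_cst.
    by apply: cvg_expr; rewrite ltr_norml; lra.
  - exact: cvg_cst.
have [t0|t0|<-] := ltgtP 0 t; rewrite ler_norml => /andP[t1 t2].
- by rewrite gtr0_sg//; apply: pos; rewrite t0.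
- rewrite ltr0_sg// (_ : (fun n => _) = (fun n => - iter n sign_step (- t))).
    by apply: cvgN; apply: pos; lra.
  by apply/funext => n; rewrite iter_sign_stepN opprK.
- rewrite sgr0; rewrite (_ : (fun n => _) = cst (0 : R)); last first.
    by apply/funext; elim => //= n ->; rewrite /sign_step/=; ring.
  exact: cvg_cst.
Qed.

End sign_iteration.

Section bounded_closure_sets.
Context (R : realType) (T : Type) (G : set (T -> R)).
Hypothesis G_bounded : forall g, G g -> exists B : R, forall x, `|g x| <= B.
Local Notation L := (bounded_closure G).
Hypothesis G_mul : forall f g, G f -> G g -> L (f \* g).
Hypothesis L1 : L (cst 1).

(** Iterating a polynomial on [f], rescaled to take values in [[-1, 1]], stays in
    the algebra and converges boundedly. *)
Lemma bounded_closure_sg f : L f -> L (fun x => Num.sg (f x)).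
Proof.
move=> Lf; have [B fB] := bounded_closure_bounded G_bounded Lf.
pose C := `|B| + 1; have C0 : 0 < C by rewrite /C ltr_pwDr.
have fC x : `|C^-1 * f x| <= 1.
  rewrite normrM gtr0_norm ?invr_gt0// mulrC ler_pdivrMr// mul1r /C.
  by rewrite (le_trans (fB x))// (le_trans (ler_norm _))// lerDl.
apply: (@bounded_closure_lim _ _ _
    (fun n x => iter n (@sign_step R) (C^-1 * f x)) _ 1) => [n|n x|x].
- elim: n => [|n IHn] /=; first exact: bounded_closureZ.
  set g := (fun x => iter n _ _) in IHn; rename IHn into Lg.
  apply: (@bounded_closure_ext _ _ _
    ((fun x => 3 / 2 * g x) \- (fun x => 2^-1 * g x ^+ 3))).
    by move=> x; rewrite /= /sign_step -/(g x); field.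
  apply: bounded_closureB; apply: bounded_closureZ => //.
  exact: (bounded_closureX G_bounded G_mul).
- exact: iter_sign_step_norm_le1.
- have -> : Num.sg (f x) = Num.sg (C^-1 * f x).
    by rewrite sgrM [Num.sg C^-1]gtr0_sg ?invr_gt0// mul1r.
  exact: cvg_iter_sign_step.
Qed.

(** The indicator of [0 < f] is [(s^2 + s) / 2], where [s] is the sign of [f]. *)
Lemma bounded_closure_pos_set f : L f -> L \1_[set x | 0 < f x].
Proof.
move=> Lf; have Ls := bounded_closure_sg Lf.
apply: (@bounded_closure_ext _ _ _ (fun x => 2^-1 *
  ((fun x => Num.sg (f x) ^+ 2) \+ (fun x => Num.sg (f x))) x)).
  move=> x /=; rewrite indicE; case: (ltgtP 0 (f x)) => fx.
  - by rewrite gtr0_sg// mem_set//=; field.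
  - by rewrite ltr0_sg// memNset/= ?ltNge ?ltW//; field.
  - by rewrite -fx sgr0 memNset/= -?fx ?ltxx//; field.
apply: bounded_closureZ; apply: bounded_closureD => //.
exact: (bounded_closureX G_bounded G_mul).
Qed.

Lemma sigma_algebra_bounded_closure :
  sigma_algebra setT [set A : set T | L \1_A].
Proof.
have LC A : L \1_A -> L \1_(~` A).
  move=> LA; apply: bounded_closure_ext (bounded_closureB L1 LA) => x /=.
  by rewrite !indicE in_setC; case: (x \in A) => /=; ring.
have LU A B : L \1_A -> L \1_B -> L \1_(A `|` B).
  move=> LA LB; apply: (@bounded_closure_ext _ _ _
      ((\1_A \+ \1_B) \- (\1_A \* \1_B : T -> R))).
    move=> x /=; rewrite !indicE in_setU.
    by case: (x \in A); case: (x \in B) => /=; ring.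
  apply: bounded_closureB; first exact: bounded_closureD.
  exact: (bounded_closureM G_bounded).
have L0 : L \1_set0.
  apply: bounded_closure_ext (bounded_closureZ 0 L1) => x /=.
  by rewrite indic0 mul0r.
split => // [A LA|F LF]; first by rewrite setTD; exact: LC.
have LFn n : L \1_(\big[setU/set0]_(i < n) F i).
  elim: n => [|n IHn]; first by rewrite big_ord0.
  by rewrite big_ord_recr/=; apply: LU => //; exact: LF.
apply: (@bounded_closure_lim _ _ _ _ _ 1 LFn) => [n x|x].
  by rewrite indicE normr_nat lern1 leq_b1.
have [xF|xF] := pselect ((\bigcup_n F n) x); last first.
  rewrite [X in _ --> X]indicE memNset//=.
  rewrite (_ : (fun n => _) = cst 0); first exact: cvg_cst.
  apply/funext => n; rewrite indicE memNset//= -bigcup_mkord.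
  by apply: contra_not xF => -[i _ Fx]; exists i.
rewrite [X in _ --> X]indicE mem_set//=.
have [k _ Fk] := xF; apply: cvg_near_cst; exists k.+1 => // n /= kn.
apply/eqP; rewrite indicE mem_set//= -bigcup_mkord; by exists k.
Qed.

End bounded_closure_sets.

(** * Damped monomials generate the Borel indicators *)

Section damped_polynomials.
Context (R : realType) (m : nat).
Implicit Types (x : m.-tuple R) (s : seq 'I_m).

(** The same functions as [damped_monomial], indexed by sequences so that words
    can be concatenated. *)
Definition damped_word (c : R) s x : R :=
  expR (- (c * sq_enorm x)) * \prod_(l <- s) tnth x l.

Lemma sq_enorm_ge0 x : 0 <= sq_enorm x.
Proof. by apply: sumr_ge0 => l _; exact: sqr_ge0. Qed.

Lemma normr_tnth_le x l : `|tnth x l| <= 1 + sq_enorm x.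
Proof.
have tx : tnth x l ^+ 2 <= sq_enorm x.
  by rewrite /sq_enorm (bigD1 l)//= lerDl sumr_ge0// => i _; exact: sqr_ge0.
by rewrite ler_norml; apply/andP; split; nra.
Qed.

Lemma damped_wordE (c : R) s :
  damped_word c s =
  damped_monomial c [ffun i : 'I_(size s) => tnth (in_tuple s) i].
Proof.
apply/funext => x; congr (_ * _).
by rewrite (big_tnth _ _ s) /word_monomial; apply: eq_bigr => i _; rewrite ffunE.
Qed.

Lemma damped_monomialE (c : R) k (w : {ffun 'I_k -> 'I_m}) :
  damped_monomial c w = damped_word c [seq w i | i <- enum 'I_k].
Proof. by apply/funext => x; rewrite /damped_word big_map big_enum. Qed.

(** Each letter consumes half of the damping rate, by
    [1 + t <= (1 + 1 / b) exp (b t)]. *)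
Lemma damped_word_bounded (c : R) s : 0 < c ->
  exists B : R, forall x, `|damped_word c s x| <= B.
Proof.
elim: s c => [|l s IHs] c c0.
  exists 1 => x; rewrite /damped_word big_nil mulr1 ger0_norm ?expR_ge0//.
  by rewrite -expR0 ler_expR oppr_le0 mulr_ge0 ?sq_enorm_ge0// ltW.
have [|B sB] := IHs (c / 2); first by rewrite divr_gt0.
exists ((1 + 2 / c) * B) => x.
have -> : damped_word c (l :: s) x =
    expR (- (c / 2 * sq_enorm x)) * tnth x l * damped_word (c / 2) s x.
  rewrite /damped_word big_cons.
  have -> : - (c * sq_enorm x) = - (c / 2 * sq_enorm x) + - (c / 2 * sq_enorm x).
    by field.
  by rewrite expRD; ring.
rewrite normrM ler_pM//.
rewrite normrM (ger0_norm (expR_ge0 _)) expRN mulrC ler_pdivrMr ?expR_gt0//.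
apply: le_trans (normr_tnth_le x l) _.
have t0 := sq_enorm_ge0 x; move: (sq_enorm x) t0 => t t0.
apply: (@le_trans _ _ ((1 + 2 / c) * (1 + c / 2 * t))).
  have -> : (1 + 2 / c) * (1 + c / 2 * t) = 1 + t + (2 / c + c / 2 * t).
    by field; rewrite gt_eqF.
  rewrite lerDl; apply: addr_ge0; first by rewrite divr_ge0// ltW.
  by rewrite mulr_ge0// divr_ge0// ltW.
rewrite ler_wpM2l ?expR_ge1Dx//.
by rewrite addr_ge0// divr_ge0// ltW.
Qed.

Lemma measurable_damped_word (c : R) s : measurable_fun setT (damped_word c s).
Proof.
apply: measurable_funM.
  apply: measurableT_comp => //; apply: measurableT_comp => //.
  apply: measurable_funM => //; apply: measurable_sum => l.
  by apply: measurable_funX; exact: measurable_tnth.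
by apply: measurable_prod => l _; exact: measurable_tnth.
Qed.

Definition damped_words (c : R) : set (m.-tuple R -> R) :=
  [set damped_word c s | s in setT].

(** The factor [exp (- b |x|^2)] is the limit of its Taylor polynomials; for
    [b < c] these stay bounded when multiplied by a word damped at rate [c]. *)
Lemma bounded_closure_damp (G : set (m.-tuple R -> R)) (b c : R) :
  0 <= b < c -> (forall s, bounded_closure G (damped_word c s)) ->
  forall s, bounded_closure G (damped_word (c + b) s).
Proof.
move=> /andP[b0 bc] Gc s.
pose F q (x : m.-tuple R) := damped_word c s x * sq_enorm x ^+ q.
have GF q : bounded_closure G (F q).
  suff : forall r,
    bounded_closure G (fun x => damped_word c r x * sq_enorm x ^+ q) by exact.
  elim: q => [|q IHq] r.
    by apply: bounded_closure_ext (Gc r) => x; rewrite mulr1.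
  apply: (@bounded_closure_ext _ _ _ (fun x => \sum_(l < m)
      damped_word c [:: l, l & r] x * sq_enorm x ^+ q)).
    move=> x; rewrite exprS [sq_enorm x * _]mulrC mulrA [RHS]mulr_sumr.
    by apply: eq_bigr => l _; rewrite /damped_word !big_cons; ring.
  elim: (index_enum _) => [|l t IHt].
    apply: bounded_closure_ext (bounded_closureZ 0 (Gc [::])) => x.
    by rewrite big_nil mul0r.
  apply: bounded_closure_ext (bounded_closureD (IHq [:: l, l & r]) IHt) => x.
  by rewrite big_cons.
have [B sB] : exists B : R, forall x, `|damped_word (c - b) s x| <= B.
  by apply: damped_word_bounded; rewrite subr_gt0.
pose f_ N (x : m.-tuple R) :=
  damped_word c s x * series (exp_coeff (- (b * sq_enorm x))) N.
have Gf N : bounded_closure G (f_ N).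
  rewrite /f_ /series/=; elim: N => [|N IHN].
    apply: bounded_closure_ext (bounded_closureZ 0 (Gc s)) => x.
    by rewrite big_geq// mulr0 mul0r.
  apply: bounded_closure_ext (bounded_closureD IHN
    (bounded_closureZ ((- b) ^+ N / N`!%:R) (GF N))) => x /=.
  rewrite big_nat_recr//= mulrDr; congr (_ + _).
  by rewrite /exp_coeff/= -mulNr exprMn /F; ring.
apply: (@bounded_closure_lim _ _ _ f_ _ B) => // [N x|x].
  apply: le_trans (sB x).
  have -> : damped_word (c - b) s x = damped_word c s x * expR (b * sq_enorm x).
    rewrite /damped_word mulrAC -expRD; congr (expR _ * _); ring.
  rewrite /f_ !normrM ler_wpM2l// (ger0_norm (expR_ge0 _)).
  have bx : 0 <= b * sq_enorm x by rewrite mulr_ge0// sq_enorm_ge0.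
  apply: (@le_trans _ _ (series (exp_coeff (b * sq_enorm x)) N)).
    rewrite /series/= (le_trans (ler_norm_sum _ _ _))//.
    apply: ler_sum => q _; rewrite /exp_coeff/= normrM normrX normrN.
    by rewrite !ger0_norm.
  apply: nondecreasing_cvgn_le.
    by apply: nondecreasing_series => q _ _; rewrite /exp_coeff/= divr_ge0// exprn_ge0.
  exact: is_cvg_series_exp_coeff.
have -> : damped_word (c + b) s x = damped_word c s x * expR (- (b * sq_enorm x)).
  rewrite /damped_word mulrAC -expRD; congr (expR _ * _); ring.
by apply: cvgM; [exact: cvg_cst|exact: is_cvg_series_exp_coeff].
Qed.

Section closure.
Variable c : R.
Hypothesis c0 : 0 < c.
Local Notation L := (bounded_closure (damped_words c)).

Lemma damped_words_bounded g : damped_words c g ->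
  exists B : R, forall x, `|g x| <= B.
Proof. by move=> [s _ <-]; exact: damped_word_bounded. Qed.

(** A product of two words damped at rate [c] is damped at rate [2 c], which is
    reached in two steps of size [c / 2]. *)
Lemma damped_words_mul f g : damped_words c f -> damped_words c g -> L (f \* g).
Proof.
move=> [s _ <-] [r _ <-]; have c2 : 0 < c / 2 by rewrite divr_gt0.
apply: (@bounded_closure_ext _ _ _ (damped_word (c + c / 2 + c / 2) (s ++ r))).
  move=> x; rewrite /damped_word/= big_cat/= mulrACA -expRD.
  by congr (expR _ * _); field.
apply: bounded_closure_damp; first by rewrite ltW//= ltrDr.
apply: bounded_closure_damp; first by rewrite ltW//= [ltRHS]splitr ltrDl.
by move=> t; apply: bounded_closure_gen; exists t.
Qed.

Lemma damped_words_closure1 : L (cst 1).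
Proof.
apply: (bounded_closure1 damped_words_bounded damped_words_mul
  (u := damped_word c [::])).
  by apply: bounded_closure_gen; exists [::].
move=> x; rewrite /damped_word big_nil mulr1 expR_gt0 -expR0 ler_expR.
by rewrite oppr_le0 mulr_ge0 ?sq_enorm_ge0// ltW.
Qed.

(** The half-space is where [(x_l - a) exp (- c |x|^2)] is positive. *)
Lemma damped_words_closure_halfspace l (a : R) : L \1_[set x | a < tnth x l].
Proof.
have Lf : L (damped_word c [:: l] \- (fun x => a * damped_word c [::] x)).
  apply: bounded_closureB; last apply: bounded_closureZ.
    by apply: bounded_closure_gen; exists [:: l].
  by apply: bounded_closure_gen; exists [::].
rewrite (_ : [set x | _] = [set x |
    0 < (damped_word c [:: l] \- (fun x => a * damped_word c [::] x)) x]).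
  exact: (bounded_closure_pos_set damped_words_bounded damped_words_mul
    damped_words_closure1).
apply/seteqP; split => x /=; rewrite /damped_word big_seq1 big_nil mulr1;
  by rewrite [a * _]mulrC -mulrBr pmulr_rgt0 ?expR_gt0// subr_gt0.
Qed.

Lemma damped_words_closure_indic (E : set (m.-tuple R)) :
  measurable E -> L \1_E.
Proof.
have sL := sigma_algebra_bounded_closure damped_words_bounded damped_words_mul
  damped_words_closure1.
have [sL0 sLC sLU] := sL.
suff : g_sigma_preimage (fun l (x : m.-tuple R) => tnth x l) `<=`
  [set E | L \1_E] by apply.
apply: smallest_sub => //.
apply: (big_ind (fun S => S `<=` [set A | L \1_A])) => // [S S' SL S'L|l _].
  by move=> A [/SL|/S'L].
move=> _ [B + <-]; rewrite setTI.
pose S := [set B : set R | L \1_((fun x => tnth x l) @^-1` B)].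
suff : measurable `<=` S by apply.
rewrite [X in X `<=` _](RGenOInfty.measurableE R).
apply: smallest_sub => [|_ [a ->]].
  split; first exact: sL0.
    by move=> A SA; rewrite /S/= setTD preimage_setC -setTD; exact: sLC.
  by move=> F SF; rewrite /S/= preimage_bigcup; exact: sLU.
rewrite /S/= (_ : _ @^-1` _ = [set x | a < tnth x l]).
  exact: damped_words_closure_halfspace.
by apply/seteqP; split => x /=; rewrite in_itv/= andbT.
Qed.

End closure.
End damped_polynomials.

(** * Damped moments determine finite measures *)

Section bounded_integrals.
Context d (T : measurableType d) (R : realType)
  (mu : {finite_measure set T -> \bar R}).

Lemma integrable_bounded_fun (f : T -> R) (B : R) : measurable_fun setT f ->
  (forall x, `|f x| <= B) -> mu.-integrable setT (EFin \o f).
Proof.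
move=> mf fB; apply: measurable_bounded_integrable => //.
  by rewrite -ge0_fin_numE//; exact: fin_num_measure.
exists B; split; first exact: num_real.
by move=> M BM x _ /=; rewrite (le_trans (fB x))// ltW.
Qed.

Lemma cvg_Rintegral_bounded (f_ : nat -> T -> R) (f : T -> R) (B : R) :
  (forall n, measurable_fun setT (f_ n)) -> measurable_fun setT f ->
  (forall n x, `|f_ n x| <= B) ->
  (forall x, f_ n x @[n --> \oo] --> f x) ->
  (\int[mu]_x f_ n x)%R @[n --> \oo] --> (\int[mu]_x f x)%R.
Proof.
move=> mf_ mf fB ff.
have iB : mu.-integrable setT (EFin \o cst B).
  by apply: (@integrable_bounded_fun _ `|B|).
have fB' x : `|f x| <= B by exact: cvg_normr_le (ff x).
have [] := @dominated_convergence _ _ _ mu _ measurableT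
  (fun n => EFin \o f_ n) (EFin \o f) (EFin \o cst B).
- by move=> n; exact/measurable_EFinP.
- exact/measurable_EFinP.
- by apply: aeW => x _; apply/fine_cvgP; split; [exact: nearW|exact: ff].
- exact: iB.
- by apply: aeW => x n _; rewrite /= lee_fin.
move=> _ _ h; apply: fine_cvg; rewrite fineK//.
apply: integrable_fin_num => //.
exact: (integrable_bounded_fun mf fB').
Qed.

End bounded_integrals.

Section closure_integrals.
Context d (T : measurableType d) (R : realType)
  (mu nu : {finite_measure set T -> \bar R}) (G : set (T -> R)).
Hypothesis G_bounded : forall g, G g -> exists B : R, forall x, `|g x| <= B.
Hypothesis G_measurable : forall g, G g -> measurable_fun setT g.
Hypothesis G_integral : forall g, G g ->
  (\int[mu]_x g x)%R = (\int[nu]_x g x)%R.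

Lemma bounded_closure_measurable f : bounded_closure G f -> measurable_fun setT f.
Proof.
elim=> {f} [f /G_measurable//|f g _ mf _ mg|a f _ mf|f_ f B _ mf_ _ ff].
- exact: measurable_funD.
- by apply: measurable_funM.
- by apply: (@measurable_fun_cvg _ _ _ _ f_) => [n|x _]; [exact: mf_|exact: ff].
Qed.

Lemma bounded_closure_integral f : bounded_closure G f ->
  (\int[mu]_x f x)%R = (\int[nu]_x f x)%R.
Proof.
have ib (la : {finite_measure set T -> \bar R}) g : bounded_closure G g ->
    la.-integrable setT (EFin \o g).
  move=> Lg; have [B gB] := bounded_closure_bounded G_bounded Lg.
  exact: integrable_bounded_fun (bounded_closure_measurable Lg) gB.
elim=> {f} [f /G_integral//|f g Lf fE Lg gE|a f Lf fE|f_ f B Lf_ f_E fB ff].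
- by rewrite !RintegralD//; [congr (_ + _)|exact: ib..].
- by rewrite !RintegralZl//; [congr (_ * _)|exact: ib..].
- have Lf := bounded_closure_lim Lf_ fB ff.
  have mf_ n := bounded_closure_measurable (Lf_ n).
  have mf := bounded_closure_measurable Lf.
  have h1 := cvg_Rintegral_bounded (mu := mu) mf_ mf fB ff.
  have h2 := cvg_Rintegral_bounded (mu := nu) mf_ mf fB ff.
  rewrite -(cvg_lim _ h1)// -(cvg_lim _ h2)//.
  by congr (lim (_ @ \oo)); apply/funext => n; exact: f_E.
Qed.

End closure_integrals.

Lemma measurable_damped_monomial (R : realType) m (c : R) k
    (w : {ffun 'I_k -> 'I_m}) : measurable_fun setT (damped_monomial c w).
Proof. by rewrite damped_monomialE; exact: measurable_damped_word. Qed.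

Lemma damped_monomial_bounded (R : realType) m (c : R) k
    (w : {ffun 'I_k -> 'I_m}) : 0 < c ->
  exists B : R, forall x, `|damped_monomial c w x| <= B.
Proof. by move=> c0; rewrite damped_monomialE; exact: damped_word_bounded. Qed.

(** Gaussian-damped moments are determinate: the damping makes every monomial
    bounded, and the bounded pointwise closure of the damped monomials is an
    algebra that contains all the indicators of Borel sets. *)
Lemma measure_eq_damped_monomials (R : realType) (m : nat) (c : R)
    (mu nu : {finite_measure set (m.-tuple R) -> \bar R}) : 0 < c ->
  (forall k (w : {ffun 'I_k -> 'I_m}),
    (\int[mu]_x damped_monomial c w x)%R =
    (\int[nu]_x damped_monomial c w x)%R) ->
  forall E, measurable E -> mu E = nu E.
Proof.
move=> c0 munu E mE.
have := @bounded_closure_integral _ _ _ mu nu (damped_words c)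
  (@damped_words_bounded _ _ _ c0) _ _ _ (damped_words_closure_indic c0 mE).
have finE (la : {finite_measure set (m.-tuple R) -> \bar R}) :
    (\int[la]_x \1_E x)%R = fine (la E).
  by rewrite /Rintegral integral_indic// setIT.
rewrite !finE => h.
rewrite -[mu E]fineK ?fin_num_measure// -[nu E]fineK ?fin_num_measure//.
by congr EFin; apply: h => _ [s _ <-];
  [exact: measurable_damped_word|rewrite damped_wordE].
Qed.

(** * Independence and second moments *)

Section rectangles.
Context d1 d2 (T1 : measurableType d1) (T2 : measurableType d2) (R : realType).

Lemma measure_eq_rectangles (mu nu : {measure set (T1 * T2) -> \bar R}) :
  (mu setT < +oo)%E ->
  (forall A B, measurable A -> measurable B -> mu (A `*` B) = nu (A `*` B)) ->
  forall E, measurable E -> mu E = nu E.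
Proof.
move=> mufin munu E mE.
pose C := [set A `*` B | A in @measurable _ T1 & B in @measurable _ T2].
apply: (measure_unique C (fun _ => setT)) => //.
- by rewrite measurable_prod_measurableType.
- move=> _ _ [A mA [B mB <-]] [A' mA' [B' mB' <-]].
  rewrite -setXI; exists (A `&` A'); first exact: measurableI.
  by exists (B `&` B') => //; exact: measurableI.
- by move=> _; exists setT => //; exists setT => //; rewrite setXTT.
- by rewrite bigcup_const.
- by move=> _ [A mA [B mB <-]]; exact: munu.
Qed.

End rectangles.

Section independence.
Context d (T : measurableType d) (R : realType) (P : probability T R).

Definition independent_rv d1 (S1 : measurableType d1) d2 (S2 : measurableType d2)
    (U1 : T -> S1) (U2 : T -> S2) := forall E1 E2,
  measurable E1 -> measurable E2 ->
  P (U1 @^-1` E1 `&` U2 @^-1` E2) = (P (U1 @^-1` E1) * P (U2 @^-1` E2))%E.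

Lemma independent_expectationM d1 (S1 : measurableType d1)
    d2 (S2 : measurableType d2) (U1 : {mfun T >-> S1}) (U2 : {mfun T >-> S2})
    (f : S1 -> R) (g : S2 -> R) (Bf Bg : R) :
  independent_rv U1 U2 ->
  measurable_fun setT f -> (forall x, `|f x| <= Bf) ->
  measurable_fun setT g -> (forall x, `|g x| <= Bg) ->
  (\int[P]_t (f (U1 t) * g (U2 t)))%R =
  (\int[P]_t f (U1 t))%R * (\int[P]_t g (U2 t))%R.
Proof.
move=> indU mf fB mg gB.
pose m1 : probability S1 R := distribution P U1.
pose m2 : probability S2 R := distribution P U2.
pose m12 : probability (S1 * S2)%type R := (m1 \x m2)%E.
pose U t := (U1 t, U2 t).
have mU : measurable_fun setT U by exact: measurable_fun_pair.
pose h (z : S1 * S2) : R := f z.1 * g z.2.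
have mh : measurable_fun setT h.
  by apply: measurable_funM; apply: measurableT_comp.
have hB z : `|h z| <= Bf * Bg by rewrite normrM ler_pM.
have if1 : m1.-integrable setT (EFin \o f) by exact: integrable_bounded_fun fB.
have ig2 : m2.-integrable setT (EFin \o g) by exact: integrable_bounded_fun gB.
have tr1 : (\int[P]_t (f (U1 t))%:E = \int[m1]_x (f x)%:E)%E.
  rewrite [RHS]integral_pushforward//; first exact/measurable_EFinP.
  apply: (@integrable_bounded_fun _ _ _ _ _ Bf) => //.
  exact: measurableT_comp.
have tr2 : (\int[P]_t (g (U2 t))%:E = \int[m2]_x (g x)%:E)%E.
  rewrite [RHS]integral_pushforward//; first exact/measurable_EFinP.
  apply: (@integrable_bounded_fun _ _ _ _ _ Bg) => //.
  exact: measurableT_comp.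
have tr : (\int[P]_t (h (U t))%:E = \int[pushforward P U]_z (h z)%:E)%E.
  rewrite [RHS]integral_pushforward//; first exact/measurable_EFinP.
  apply: (@integrable_bounded_fun _ _ _ _ _ (Bf * Bg)) => //.
  exact: measurableT_comp.
have prodE E : measurable E -> (m1 \x m2)%E E = pushforward P U E.
  apply: product_measure_unique => A B mA mB.
  by rewrite /pushforward -(indU _ _ mA mB).
rewrite /Rintegral tr1 tr2 -[X in fine X](_ : (\int[P]_t (h (U t))%:E)%E = _)//.
rewrite tr (eq_measure_integral (m1 \x m2)%E); last first.
  by move=> E mE' _; apply/esym; exact: prodE.
rewrite -integral12_prod_meas1; last first.
  exact: (integrable_bounded_fun m12 mh hB).
rewrite -fineM; [|exact: integrable_fin_num..]; congr fine.
have fF x : fubini_F m2 (EFin \o h) x =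
    ((f x)%:E * \int[m2]_y (g y)%:E)%E.
  by rewrite -(integralZl measurableT ig2).
under eq_integral => x _ do rewrite fF.
have gfin : (\int[m2]_y (g y)%:E)%E \is a fin_num.
  exact: (integrable_fin_num measurableT ig2).
rewrite -[X in (_ = _ * X)%E]fineK//.
rewrite -(integralZr measurableT if1).
by apply: eq_integral => x _; rewrite fineK.
Qed.

Lemma independent_rect d1 (S1 : measurableType d1) d2 (S2 : measurableType d2)
    (U : T -> S1 * S2) (D : set T) : measurable_fun setT U -> measurable D ->
  (forall A B, measurable A -> measurable B ->
    P (U @^-1` (A `*` B) `&` D) = (P (U @^-1` (A `*` B)) * P D)%E) ->
  forall E, measurable E -> P (U @^-1` E `&` D) = (P (U @^-1` E) * P D)%E.
Proof.
move=> mU mD UD E mE.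
pose mu : {measure set (S1 * S2) -> \bar R} :=
  pushforward (mrestr P mD) U.
have pD0 : 0 <= fine (P D) by rewrite fine_ge0.
pose nu : {measure set (S1 * S2) -> \bar R} :=
  mscale (NngNum pD0) (pushforward P U).
have nuE X : nu mU X = (P (U @^-1` X) * P D)%E.
  by rewrite /nu/= /mscale/= fineK ?fin_num_measure// muleC.
rewrite -nuE; apply: (@measure_eq_rectangles _ _ _ _ _ (mu mU) (nu mU)) => //.
- rewrite /mu/= /pushforward /mrestr preimage_setT setTI.
  by rewrite -ge0_fin_numE// fin_num_measure.
- by move=> A B mA mB; rewrite nuE; exact: UD.
Qed.

(** The rectangles are stable under intersection, and a measure is determined by
    them; this is used once for each of the two variables. *)
Lemma independent_rv_rect d1 (S1 : measurableType d1) d2 (S2 : measurableType d2)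
    d3 (S3 : measurableType d3) d4 (S4 : measurableType d4)
    (U : T -> S1 * S2) (U' : T -> S3 * S4) :
  measurable_fun setT U -> measurable_fun setT U' ->
  (forall A B A' B', measurable A -> measurable B ->
    measurable A' -> measurable B' ->
    P (U @^-1` (A `*` B) `&` U' @^-1` (A' `*` B')) =
    (P (U @^-1` (A `*` B)) * P (U' @^-1` (A' `*` B')))%E) ->
  independent_rv U U'.
Proof.
move=> mU mU' UU' E E' mE mE'.
have pre d5 (S5 : measurableType d5) (F : T -> S5) X :
    measurable_fun setT F -> measurable X -> measurable (F @^-1` X).
  by move=> mF mX; rewrite -[_ @^-1` _]setTI; exact: mF.
apply: independent_rect => //; first exact: pre.
move=> A B mA mB; rewrite setIC muleC; apply: independent_rect => //.
  by apply: pre => //; exact: measurableX.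
by move=> A' B' mA' mB'; rewrite setIC muleC; exact: UU'.
Qed.

Lemma Rintegral_sum (I : Type) (s : seq I) (F : I -> T -> R) :
  (forall i, P.-integrable setT (EFin \o F i)) ->
  P.-integrable setT (EFin \o (fun t => \sum_(i <- s) F i t)) /\
  (\int[P]_t (\sum_(i <- s) F i t))%R = \sum_(i <- s) (\int[P]_t F i t)%R.
Proof.
move=> iF; elim: s => [|i s [iFs IHs]].
  under [X in EFin \o X]eq_fun do rewrite big_nil.
  split.
    by apply: (@integrable_bounded_fun _ _ _ _ _ 0) => // t; rewrite normr0.
  by under eq_Rintegral do rewrite big_nil; rewrite big_nil Rintegral_cst// mul0r.
have -> : (fun t => \sum_(j <- i :: s) F j t) =
    F i \+ (fun t => \sum_(j <- s) F j t).
  by apply/funext => t; rewrite big_cons.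
split; first exact: (integrableD measurableT (iF i) iFs).
by rewrite RintegralD// IHs big_cons.
Qed.

(** Chebyshev's inequality for uncorrelated centred bounded variables: only the
    diagonal terms of the second moment survive. *)
Lemma uncorrelated_sum_tail (n : nat) (xi : 'I_n -> T -> R) (B e : R) :
  (forall i, measurable_fun setT (xi i)) -> (forall i t, `|xi i t| <= B) ->
  (forall i j, i != j -> (\int[P]_t (xi i t * xi j t))%R = 0) -> 0 < e ->
  (P [set t | (e <= `|\sum_i xi i t|)%R] <= (n%:R * B ^+ 2 / e ^+ 2)%:E)%E.
Proof.
move=> mxi xiB uncor e0.
have int_xi i j : P.-integrable setT (EFin \o (fun t => xi i t * xi j t)).
  apply: (@integrable_bounded_fun _ _ _ _ _ (B * B)) => [|t].
    by apply: measurable_funM.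
  by rewrite normrM ler_pM.
have [iS ES] : P.-integrable setT (EFin \o (fun t => (\sum_i xi i t) ^+ 2)) /\
    (\int[P]_t ((\sum_i xi i t) ^+ 2))%R =
    \sum_i \sum_j (\int[P]_t (xi i t * xi j t))%R.
  under [X in EFin \o X]eq_fun do rewrite expr2 big_distrlr/=.
  under eq_Rintegral do rewrite expr2 big_distrlr/=.
  have H i := @Rintegral_sum _ (index_enum 'I_n) (fun j t => xi i t * xi j t)
    (int_xi i).
  have [? ->] := @Rintegral_sum _ (index_enum 'I_n)
    (fun i t => \sum_j xi i t * xi j t) (fun i => (H i).1).
  by split => //; apply: eq_bigr => i _; rewrite (H i).2.
have second : (\int[P]_t ((\sum_i xi i t) ^+ 2))%R <= n%:R * B ^+ 2.
  rewrite ES -[n in leRHS]card_ord mulr_natl -sumr_const.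
  apply: ler_sum => i _; rewrite (bigD1 i)//= big1 ?addr0; last first.
    by move=> j ji; rewrite uncor// eq_sym.
  apply: (@le_trans _ _ (\int[P]_t (B ^+ 2))%R).
    apply: le_Rintegral => // [|t _].
      by apply: (@integrable_bounded_fun _ _ _ _ _ (`|B ^+ 2|)).
    rewrite -expr2 -(ger0_norm (sqr_ge0 _)) normrX lerXn2r ?nnegrE//.
    by rewrite (le_trans _ (xiB i t)).
  by rewrite Rintegral_cst// [X in fine X](probability_setT P) mulr1.
pose S t := \sum_i xi i t.
have mS : measurable_fun setT (fun t => (S t ^+ 2)%:E).
  by case/integrableP : iS.
have e2 : 0 < e ^+ 2 by rewrite exprn_gt0.
set A := [set t | _]; have mA : measurable A.
  rewrite -[A]setTI; apply: measurable_fun_le => //.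
  by apply: measurableT_comp => //; exact: measurable_sum.
have := le_integral_abse P measurableT mS e2; rewrite setTI.
have -> : [set t | ((e ^+ 2)%:E <= `|(S t ^+ 2)%:E|)%E] = A.
  apply/seteqP; split => t; rewrite /A/= lee_fin normrX ler_sqr ?nnegrE//;
    exact: ltW.
have -> : (\int[P]_t `|(S t ^+ 2)%:E| = (\int[P]_t (S t ^+ 2))%R%:E)%E.
  rewrite /Rintegral fineK; last exact: (integrable_fin_num measurableT iS).
  by apply: eq_integral => t _; rewrite /= ger0_norm// sqr_ge0.
have PA : P A \is a fin_num by exact: fin_num_measure.
rewrite -(fineK PA) [X in (_ * X)%E](_ : _ = (fine (P A))%:E); last first.
  by rewrite fineK.
rewrite -EFinM !lee_fin ler_pdivlMr// mulrC => h.
exact: le_trans h second.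
Qed.

End independence.

(** * The law of a resampled observation *)

Section probability_kernel_values.
Context d d' (S : measurableType d) (S' : measurableType d') (R : realType)
  (kappa : R.-pker S ~> S').

Lemma pker_le1 z A : measurable A -> (kappa z A <= 1)%E.
Proof. by move=> mA; rewrite -(prob_kernel (s := kappa) z) le_measure ?inE. Qed.

Lemma pker_fin_num z A : measurable A -> kappa z A \is a fin_num.
Proof.
by move=> mA; rewrite ge0_fin_numE// (le_lt_trans (pker_le1 z mA))// ltry.
Qed.

End probability_kernel_values.

Lemma in_preimage (S T : Type) (f : S -> T) (A : set T) (s : S) :
  (s \in f @^-1` A) = (f s \in A).
Proof. by apply/idP/idP; rewrite !inE. Qed.

Section sampling.
Context d (T : measurableType d) (R : realType) (Pr : probability T R)
  (dX dY dZ : nat) (P : probability (obs R dX dY dZ) R)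
  (kappa : R.-pker (dZ.-tuple R) ~> (dX.-tuple R)) (n : nat)
  (V : 'I_n -> {RV Pr >-> obs R dX dY dZ})
  (X' : 'I_n -> {RV Pr >-> dX.-tuple R}).
Hypothesis V_iid : iid P V.
Hypothesis X'_drawn : drawn_given_sample kappa V X'.
Implicit Types (B : set (obs R dX dY dZ)) (A : set (dX.-tuple R)).

Definition resampled i (t : T) : obs R dX dY dZ * dX.-tuple R := (V i t, X' i t).

Lemma measurable_resampled i : measurable_fun setT (resampled i).
Proof. exact: measurable_fun_pair. Qed.

HB.instance Definition _ i := isMeasurableFun.Build _ _ _ _ (resampled i)
  (measurable_resampled i).

(** The conditional probability of [X' in A], cut down to the event [V in B]. *)
Definition kernel_weight B A (v : obs R dX dY dZ) : R :=
  \1_B v * fine (kappa (zpart v) A).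

Lemma kernel_weight_norm_le1 B A v : measurable A -> `|kernel_weight B A v| <= 1.
Proof.
move=> mA; rewrite /kernel_weight normrM indicE normr_nat.
rewrite ger0_norm ?fine_ge0// mulr_ile1 ?fine_ge0 ?lern1 ?leq_b1//.
by rewrite -lee_fin fineK ?pker_le1// pker_fin_num.
Qed.

Lemma measurable_kernel_weight B A : measurable B -> measurable A ->
  measurable_fun setT (kernel_weight B A).
Proof.
move=> mB mA; apply: measurable_funM; first exact: measurable_indic.
apply: measurableT_comp => //.
apply: (@measurableT_comp _ _ _ _ _ _ (fun z => kappa z A)).
  exact: measurable_kernel.
exact: measurable_snd.
Qed.

Lemma sample_preimage_measurable i B : measurable B ->
  g_sigma_preimage (fun i => V i : T -> obs R dX dY dZ) (V i @^-1` B).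
Proof.
move=> mB; apply: sub_sigma_algebra.
by rewrite (bigD1 i)//=; left; exists B => //; rewrite setTI.
Qed.

Lemma resampled_law_rect i B A : measurable B -> measurable A ->
  Pr (resampled i @^-1` (B `*` A)) =
  (\int[Pr]_t kernel_weight B A (V i t))%R%:E.
Proof.
move=> mB mA; pose A_ k := if k == i then A else setT.
have mA_ k : measurable (A_ k) by rewrite /A_; case: ifP.
have [_ _ /(_ (V i @^-1` B) (sample_preimage_measurable i mB))] := X'_drawn mA_.
have -> : \bigcap_k (X' k @^-1` A_ k) `&` V i @^-1` B =
    resampled i @^-1` (B `*` A).
  apply/seteqP; split => t /= [].
    by move=> /(_ i I); rewrite /A_ eqxx => At Bt; split.
  move=> Bt At; split => // k _; rewrite /A_; case: eqP => // ->; exact: At.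
move=> ->; rewrite integral_mkcond /Rintegral fineK; last first.
  apply: (integrable_fin_num measurableT).
  apply: (@integrable_bounded_fun _ _ _ Pr (kernel_weight B A \o V i) 1).
    by apply: measurableT_comp => //; exact: measurable_kernel_weight.
  by move=> t; exact: kernel_weight_norm_le1.
apply: eq_integral => t _; rewrite patchE /kernel_weight EFinM.
rewrite fineK ?pker_fin_num// indicE in_preimage.
case: (V i t \in B); rewrite ?mul0e ?mul1e//=.
rewrite (bigD1 i)//= big1 ?mule1 => [|k ki]; first by rewrite /A_ eqxx.
by rewrite /A_ (negbTE ki) prob_kernel.
Qed.

Lemma resampled_law_rect2 i j B A B' A' : i != j ->
  measurable B -> measurable A -> measurable B' -> measurable A' ->
  Pr (resampled i @^-1` (B `*` A) `&` resampled j @^-1` (B' `*` A')) =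
  (\int[Pr]_t (kernel_weight B A (V i t) * kernel_weight B' A' (V j t)))%R%:E.
Proof.
move=> ij mB mA mB' mA'; have ji : (j == i) = false by rewrite eq_sym (negbTE ij).
pose A_ k := if k == i then A else if k == j then A' else setT.
have mA_ k : measurable (A_ k) by rewrite /A_; do 2 case: ifP => // _.
pose C := V i @^-1` B `&` V j @^-1` B'.
have sC : g_sigma_preimage (fun i => V i : T -> obs R dX dY dZ) C.
  apply: (@measurableI _ (g_sigma_algebraType (\big[setU/set0]_(i < n)
    preimage_set_system setT (V i : T -> obs R dX dY dZ) measurable)));
    exact: sample_preimage_measurable.
have [_ _ /(_ C sC)] := X'_drawn mA_.
have -> : \bigcap_k (X' k @^-1` A_ k) `&` C =
    resampled i @^-1` (B `*` A) `&` resampled j @^-1` (B' `*` A').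
  apply/seteqP; split => t /=.
    move=> [At [Bt B't]]; split; split => //=.
      by have := At i I; rewrite /A_ eqxx.
    by have := At j I; rewrite /A_ ji eqxx.
  move=> [[Bt At] [B't A't]]; split => // k _; rewrite /A_.
  case: eqP => [->|_]; first exact: At.
  by case: eqP => [->|_]; first exact: A't.
move=> ->; rewrite integral_mkcond /Rintegral fineK; last first.
  apply: (integrable_fin_num measurableT).
  apply: (@integrable_bounded_fun _ _ _ Pr
    ((kernel_weight B A \o V i) \* (kernel_weight B' A' \o V j)) (1 * 1)).
    by apply: measurable_funM; apply: measurableT_comp => //;
      exact: measurable_kernel_weight.
  by move=> t; rewrite normrM ler_pM//; exact: kernel_weight_norm_le1.
apply: eq_integral => t _; rewrite patchE /kernel_weight !EFinM.
rewrite !fineK ?pker_fin_num// !indicE in_setI (in_preimage (V i)) (in_preimage (V j)).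
case: (V i t \in B); case: (V j t \in B'); rewrite !(mul0e, mule0, mul1e)//=.
rewrite (bigD1 i)//= (bigD1 j)/=; last by rewrite eq_sym.
rewrite big1 ?mule1 => [|k /andP[ki kj]]; first by rewrite /A_ eqxx ji eqxx.
by rewrite /A_ (negbTE ki) (negbTE kj) prob_kernel.
Qed.

Lemma sample_independent i j : i != j -> independent_rv Pr (V i) (V j).
Proof.
move=> ij E E' mE mE'; have [Vind _] := V_iid.
pose F k := if k == i then E else E'.
have mF k : measurable (F k) by rewrite /F; case: ifP.
have := Vind [set i; j]%SET F mF.
rewrite big_setU1 ?inE//= big_set1 /F eqxx eq_sym (negbTE ij) => <-.
congr (Pr _); apply/seteqP; split => t /=.
  move=> [Et E't] k /=; rewrite !inE => /orP[/eqP->|/eqP->].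
    by rewrite eqxx.
  by rewrite eq_sym (negbTE ij).
move=> h; split; first by have := h i; rewrite /= !inE eqxx => /(_ isT).
by have := h j; rewrite /= !inE eqxx orbT eq_sym (negbTE ij) => /(_ isT).
Qed.

(** On rectangles the joint probability is the mean of a product of functions of
    [V i] and [V j], and these observations are independent. *)
Lemma resampled_independent i j : i != j ->
  independent_rv Pr (resampled i) (resampled j).
Proof.
move=> ij; apply: independent_rv_rect; [exact: measurable_resampled..|].
move=> B A B' A' mB mA mB' mA'.
rewrite resampled_law_rect2// !resampled_law_rect// -EFinM; congr EFin.
apply: (@independent_expectationM _ _ _ _ _ _ _ _ _ _ _ _ 1 1).
- exact: sample_independent.
- exact: measurable_kernel_weight.
- by move=> v; exact: kernel_weight_norm_le1.
- exact: measurable_kernel_weight.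
- by move=> v; exact: kernel_weight_norm_le1.
Qed.

(** The kernel weights depend on the sampled observation only, so that the
    common law of the resampled observations is determined by [P]. *)
Lemma resampled_law_rectE i B A : measurable B -> measurable A ->
  Pr (resampled i @^-1` (B `*` A)) =
  (\int[P]_(v in B) kappa (zpart v) A)%E.
Proof.
move=> mB mA; rewrite resampled_law_rect//.
have [_ Vlaw] := V_iid.
have mk := measurable_kernel_weight mB mA.
have ik (mu : probability (obs R dX dY dZ) R) :
    mu.-integrable setT (EFin \o kernel_weight B A).
  by apply: (@integrable_bounded_fun _ _ _ mu _ 1 mk) => v;
    exact: kernel_weight_norm_le1.
have iV : Pr.-integrable setT (EFin \o (kernel_weight B A \o V i)).
  apply: (@integrable_bounded_fun _ _ _ Pr _ 1) => [|t].
    exact: measurableT_comp.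
  exact: kernel_weight_norm_le1.
rewrite /Rintegral fineK; last exact: (integrable_fin_num measurableT iV).
transitivity (\int[distribution Pr (V i)]_v (kernel_weight B A v)%:E)%E.
  by rewrite integral_pushforward//; exact/measurable_EFinP.
rewrite (eq_measure_integral P); last by move=> E mE _; exact: Vlaw.
rewrite [RHS]integral_mkcond; apply: eq_integral => v _.
rewrite patchE /kernel_weight EFinM fineK ?pker_fin_num// indicE.
by case: (v \in B); rewrite ?mul0e ?mul1e.
Qed.

End sampling.

(** * Conditional independence from a kernel *)

Lemma ge0_integral_mrestr d (T : measurableType d) (R : realType)
    (mu : {measure set T -> \bar R}) (D C : set T) (mD : measurable D)
    (f : T -> \bar R) : measurable C -> measurable_fun setT f ->
  (forall t, (0 <= f t)%E) ->
  (\int[mrestr mu mD]_(t in C) f t = \int[mu]_(t in D `&` C) f t)%E.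
Proof.
move=> mC mf f0.
have mCD : measurable (D `&` C) by exact: measurableI.
have mCD' : measurable (C `\` D) by exact: measurableD.
rewrite -{1}(setUIDK C D) [C `&` D]setIC ge0_integral_setU//; last 2 first.
- exact: measurable_funTS.
- by apply/disj_setPS; rewrite setDE => t [[Dt _] [_ /(_ Dt)]].
rewrite addeC null_set_integral//; last 2 first.
- exact: measurable_funTS.
- by rewrite /= /mrestr setIC setDIK measure0.
rewrite add0e; apply: eq_measure_integral => A mA AD.
by rewrite /= /mrestr setIidl// => t /AD[].
Qed.

Section conditioning_sigma_algebra.
Context d (T : measurableType d) (R : realType) (P : probability T R)
  dC (SC : measurableType dC) (Z : {mfun T >-> SC}).

(** The space [T] with the sigma-algebra generated by [Z]: an integral over it
    sees only [Z]-measurable sets, so that integrable functions with equal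
    integrals over these sets agree almost surely. *)
Definition conditioning_type := g_sigma_algebra_preimageType (Z : T -> SC).
Definition conditioning (t : T) : conditioning_type := t.

Lemma measurable_conditioning : measurable_fun setT conditioning.
Proof.
move=> _ A [B mB <-]; rewrite !setTI -[X in measurable X]setTI.
exact: measurable_funP.
Qed.

HB.instance Definition _ := isMeasurableFun.Build _ _ _ _ conditioning
  measurable_conditioning.

Definition conditioning_law := distribution P conditioning.
HB.instance Definition _ := Probability.on conditioning_law.

Local Notation TF := conditioning_type.
Local Notation PF := conditioning_law.

Lemma conditioning_law_ae_eq (f g : T -> \bar R) :
  ae_eq PF setT (f : TF -> \bar R) g -> {ae P, forall t, f t = g t}.
Proof.
move=> [N [mN N0 fgN]]; exists N; split => //.
  rewrite -[N]setTI; exact: (measurable_conditioning measurableT mN).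
by move=> t /= fgt; apply: fgN => /= h; apply: fgt; exact: h.
Qed.

Lemma conditioning_measurable_fun (f : T -> \bar R) :
  (forall B : set (\bar R), measurable B -> generated_sigma Z (f @^-1` B)) ->
  measurable_fun setT (f : TF -> \bar R).
Proof. by move=> mf _ B mB; rewrite setTI; exact: mf. Qed.

Lemma conditioning_integral (f : TF -> \bar R) (C : set TF) :
  measurable_fun setT f -> P.-integrable setT (f : T -> \bar R) ->
  measurable C ->
  (\int[PF]_(t in C) f t = \int[P]_(t in (C : set T)) f t)%E.
Proof.
move=> mf intf mC; rewrite integral_pushforward//.
apply: integrableS intf => //.
by rewrite -[X in measurable X]setTI; exact: (measurable_conditioning measurableT mC).
Qed.

Lemma conditioning_integrable (f : TF -> \bar R) :
  measurable_fun setT f -> P.-integrable setT (f : T -> \bar R) ->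
  PF.-integrable setT f.
Proof. by move=> mf intf; exact: integrable_pushforward. Qed.

Lemma cond_prob_unique (A : set T) (f g : T -> \bar R) :
  is_cond_prob P (generated_sigma Z) A f ->
  is_cond_prob P (generated_sigma Z) A g ->
  ae_eq PF setT (f : TF -> \bar R) g.
Proof.
move=> [intf mf fE] [intg mg gE].
have mf' := conditioning_measurable_fun mf.
have mg' := conditioning_measurable_fun mg.
apply: integral_ae_eq => //; first exact: conditioning_integrable.
by move=> E _ mE; rewrite !conditioning_integral// -fE// -gE.
Qed.

End conditioning_sigma_algebra.

Section restricted_law.
Context d (T : measurableType d) (R : realType) (P : probability T R)
  dC (SC : measurableType dC) (Z : {mfun T >-> SC}) (D : set T).
Hypothesis mD : measurable D.
Local Notation TF := (conditioning_type Z).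
Local Notation PF := (@conditioning_law _ _ _ P _ _ Z).

(** The measure [C |-> P (D, C)] on the conditioning sigma-algebra; its density
    with respect to the law on that sigma-algebra is the conditional probability
    of [D]. *)
Definition restricted_law : set TF -> \bar R :=
  pushforward (mrestr P mD) (conditioning Z).

Let restricted_law0 : restricted_law set0 = 0%E.
Proof. by rewrite /restricted_law /pushforward preimage_set0 measure0. Qed.

Let restricted_law_ge0 A : (0 <= restricted_law A)%E.
Proof. by rewrite /restricted_law /pushforward /mrestr measure_ge0. Qed.

Let restricted_law_sigma_additive : semi_sigma_additive restricted_law.
Proof. exact: (@measure_semi_sigma_additive _ _ _ (pushforward _ _)). Qed.

HB.instance Definition _ := isMeasure.Build _ _ _ restricted_law
  restricted_law0 restricted_law_ge0 restricted_law_sigma_additive.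

Let restricted_law_fin : fin_num_fun restricted_law.
Proof.
move=> A mA; rewrite /restricted_law /pushforward /mrestr fin_num_measure//.
apply: measurableI => //; rewrite -[X in measurable X]setTI.
exact: (measurable_conditioning (Z := Z) measurableT mA).
Qed.

HB.instance Definition _ := @Measure_isFinite.Build _ _ _ restricted_law
  restricted_law_fin.

Lemma restricted_law_dominated : restricted_law `<< PF.
Proof.
apply/null_content_dominatesP => A mA PA0.
apply/eqP; rewrite -measure_le0 -PA0 /restricted_law /PF /pushforward /mrestr.
have mA' : measurable (conditioning Z @^-1` A).
  by rewrite -[X in measurable X]setTI; exact: (measurable_conditioning measurableT mA).
have : (P (conditioning Z @^-1` A `&` D) <= P (conditioning Z @^-1` A))%E.
  by apply: le_measure; rewrite ?inE//; exact: measurableI.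
exact.
Qed.

(** What is known can be pulled out of a conditional expectation. Both sides are
    the integral of [f] against [C |-> P (D, C)], since [g] is its density. *)
Lemma cond_prob_pull_out (f g : T -> \bar R) (B : R) (C : set T) :
  is_cond_prob P (generated_sigma Z) D g ->
  (forall E, measurable E -> generated_sigma Z (f @^-1` E)) ->
  (forall t, 0 <= f t <= B%:E)%E -> generated_sigma Z C ->
  (\int[PF]_(t in C) (f t * g t) = \int[P]_(t in D `&` C) f t)%E /\
  PF.-integrable C (fun t => f t * g t)%E.
Proof.
move=> [intg mg gE] mf f0B mC.
have mf' := conditioning_measurable_fun mf.
have mg' := conditioning_measurable_fun mg.
have mfT : measurable_fun setT f.
  move=> _ E mE; rewrite setTI -[X in measurable X]setTI.
  exact: (measurable_conditioning measurableT (mf _ mE)).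
have mCF : measurable (C : set TF) := mC.
have mCT : measurable C.
  by rewrite -[X in measurable X]setTI; exact: (measurable_conditioning measurableT mC).
pose nu : {finite_measure set TF -> \bar R} := restricted_law.
have dom : charge_of_finite_measure nu `<< PF := restricted_law_dominated.
pose r := Radon_Nikodym (charge_of_finite_measure nu) PF.
have ir : PF.-integrable setT r := Radon_Nikodym_integrable dom.
have mr : measurable_fun setT r by case/integrableP : ir.
have gr : ae_eq PF setT (g : TF -> \bar R) r.
  apply: integral_ae_eq => //; first exact: conditioning_integrable.
  move=> E _ mE; have <- := Radon_Nikodym_integral dom mE.
  by rewrite conditioning_integral// -gE// setIC.
have iB (mu : {finite_measure set TF -> \bar R}) : 
    mu.-integrable (C : set TF) (EFin \o cst B).
  by apply: (integrableS measurableT mCF) => //; exact: finite_measure_integrable_cst.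
have intf : nu.-integrable (C : set TF) (f : TF -> \bar R).
  apply: (le_integrable mCF _ _ (iB nu)) => [|t _]; first exact: measurable_funTS.
  have /andP[f0 fB] := f0B t.
  rewrite gee0_abs//= ger0_norm// -lee_fin; exact: le_trans f0 fB.
have change := Radon_Nikodym_change_of_variables dom mCF intf.
have f0 t : (0 <= f t)%E by have /andP[] := f0B t.
split.
  rewrite -ge0_integral_mrestr// -[RHS](@ge0_integral_pushforward _ _ _ _ _
    (conditioning Z) (measurable_conditioning (Z := Z)) (mrestr P mD) C)//;
    last exact: measurable_funTS.
  rewrite -[RHS]change; apply: ae_eq_integral => //.
  - by apply: emeasurable_funM; exact: measurable_funTS.
  - by apply: emeasurable_funM; exact: measurable_funTS.
  - by apply: ae_eqe_mul2l; apply: ae_eq_subset gr.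
have iBg : PF.-integrable (C : set TF) (fun t => B%:E * g t)%E.
  apply: integrableZl => //; apply: integrableS (conditioning_integrable mg' intg) => //.
apply: (le_integrable mCF _ _ iBg) => [|t _].
  by apply: emeasurable_funM; exact: measurable_funTS.
rewrite !abseM lee_wpmul2r//.
have /andP[f0t fB] := f0B t.
by rewrite gee0_abs//= ger0_norm// -lee_fin (le_trans f0t fB).
Qed.

End restricted_law.

(** If replacing [X] by an independent draw from the kernel does not change the
    joint law, then conditionally on [Z] the kernel governs [X] on every event of
    [Y], and the conditional probabilities factorize. *)
Lemma cond_indep_of_kernel d (T : measurableType d) (R : realType)
    (P : probability T R) dA (SA : measurableType dA) (X : T -> SA)
    dB (SB : measurableType dB) (Y : {mfun T >-> SB})
    dC (SC : measurableType dC) (Z : {mfun T >-> SC})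
    (kappa : R.-pker SC ~> SA) :
  is_cond_dist P X Z kappa ->
  (forall A B C, measurable A -> measurable B -> measurable C ->
    P (X @^-1` A `&` (Y @^-1` B `&` Z @^-1` C)) =
    \int[P]_(t in Y @^-1` B `&` Z @^-1` C) kappa (Z t) A)%E ->
  cond_indep P X Y Z.
Proof.
move=> Xkappa law A B f g h mA mB fA gB hAB.
apply: (conditioning_law_ae_eq (Z := Z)).
have mYB : measurable (Y @^-1` B).
  by rewrite -[X in measurable X]setTI; exact: measurable_funP.
have kA := Xkappa A mA; have [_ mk _] := kA.
have k01 t : (0 <= kappa (Z t) A <= 1%:E)%E by rewrite measure_ge0 pker_le1.
have pull C := cond_prob_pull_out mYB (C := C) gB mk k01.
have [_ mg _] := gB; have mg' := conditioning_measurable_fun mg.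
have mk' := conditioning_measurable_fun mk.
set PF := @conditioning_law _ _ _ P _ _ Z.
have kf : ae_eq PF setT (fun t : conditioning_type Z => kappa (Z t) A * g t)%E
    (fun t => f t * g t)%E.
  have := ae_eqe_mul2l (g : conditioning_type Z -> \bar R)
    (cond_prob_unique kA fA).
  by congr (ae_eq _ _ _ _); apply/funext => t /=; rewrite muleC.
apply: ae_eq_trans kf.
have [inth mh hE] := hAB; have mh' := conditioning_measurable_fun mh.
apply: integral_ae_eq => //.
- exact: conditioning_integrable.
- exact: emeasurable_funM.
move=> E _ mE; rewrite (pull E mE).1 conditioning_integral// -hE//.
have [C mC <-] := mE; rewrite setTI -law// setIA; congr (P _).
Qed.

(** * Measurability of the statistic *)

Section obs_vector_coordinates.
Context (R : realType) (dX dY dZ : nat) (x : dX.-tuple R) (y : dY.-tuple R)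
  (z : dZ.-tuple R).

Lemma tnth_obs_vector_x l :
  tnth (obs_vector x y z) (lshift dZ (lshift dY l)) = tnth x l.
Proof. by rewrite /obs_vector !tnth_lshift. Qed.

Lemma tnth_obs_vector_y l :
  tnth (obs_vector x y z) (lshift dZ (rshift dX l)) = tnth y l.
Proof. by rewrite /obs_vector tnth_lshift tnth_rshift. Qed.

Lemma tnth_obs_vector_z l : tnth (obs_vector x y z) (rshift (dX + dY) l) = tnth z l.
Proof. by rewrite /obs_vector tnth_rshift. Qed.

End obs_vector_coordinates.

Section measurability.
Context d (T : measurableType d) (R : realType).

Lemma measurable_obs_vector (dX dY dZ : nat) (x : T -> dX.-tuple R)
    (y : T -> dY.-tuple R) (z : T -> dZ.-tuple R) :
  measurable_fun setT x -> measurable_fun setT y -> measurable_fun setT z ->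
  measurable_fun setT (fun t => obs_vector (x t) (y t) (z t)).
Proof.
move=> mx my mz; apply/measurable_fun_tnthP => i.
have tn m (w : T -> m.-tuple R) (l : 'I_m) : measurable_fun setT w ->
    measurable_fun setT (fun t => tnth (w t) l).
  by move=> mw; apply: (measurableT_comp (measurable_tnth l)).
case: (split_ordP i) => [j|l] ->.
  case: (split_ordP j) => [l|l] ->.
    by rewrite (_ : _ \o _ = (fun t => tnth (x t) l));
      [exact: tn|apply/funext => t; exact: tnth_obs_vector_x].
  by rewrite (_ : _ \o _ = (fun t => tnth (y t) l));
    [exact: tn|apply/funext => t; exact: tnth_obs_vector_y].
by rewrite (_ : _ \o _ = (fun t => tnth (z t) l));
  [exact: tn|apply/funext => t; exact: tnth_obs_vector_z].
Qed.

Lemma measurable_gauss_kernel (sigma : R) (m : nat) (x y : T -> m.-tuple R) :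
  measurable_fun setT x -> measurable_fun setT y ->
  measurable_fun setT (fun t => gauss_kernel sigma (x t) (y t)).
Proof.
move=> mx my; apply: measurableT_comp => //; apply: measurableT_comp => //.
apply: measurable_funM => //; apply: measurable_funM => //.
apply: measurable_sum => l; apply: measurable_funX.
by apply: measurable_funB; apply: (measurableT_comp (measurable_tnth l)).
Qed.

Lemma measurable_zeta_hat (sigma : R) (dX dY dZ n : nat)
    (X X' : 'I_n -> T -> dX.-tuple R) (Y : 'I_n -> T -> dY.-tuple R)
    (Z : 'I_n -> T -> dZ.-tuple R) :
  (forall i, measurable_fun setT (X i)) ->
  (forall i, measurable_fun setT (X' i)) ->
  (forall i, measurable_fun setT (Y i)) ->
  (forall i, measurable_fun setT (Z i)) ->
  measurable_fun setT (fun t =>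
    zeta_hat sigma (X^~ t) (X'^~ t) (Y^~ t) (Z^~ t)).
Proof.
move=> mX mX' mY mZ; apply: measurable_funM => //.
apply: measurable_sum => i; under eq_fun do rewrite big_mkcond/=.
apply: measurable_sum => j; case: (i < j)%N => //.
by apply: measurable_funB; [apply: measurable_funB; [apply: measurable_funD|]|];
  apply: measurable_gauss_kernel; exact: measurable_obs_vector.
Qed.

Lemma measurable_p_value (sigma : R) (dX dY dZ n : nat)
    (X X' : 'I_n -> T -> dX.-tuple R) (Y : 'I_n -> T -> dY.-tuple R)
    (Z : 'I_n -> T -> dZ.-tuple R) :
  (forall i, measurable_fun setT (X i)) ->
  (forall i, measurable_fun setT (X' i)) ->
  (forall i, measurable_fun setT (Y i)) ->
  (forall i, measurable_fun setT (Z i)) ->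
  measurable_fun setT (fun t =>
    p_value sigma (X^~ t) (X'^~ t) (Y^~ t) (Z^~ t)).
Proof.
move=> mX mX' mY mZ; apply: measurable_funM => //.
apply: measurable_sum => pi.
have mswap b i : measurable_fun setT (fun t => swap b (X i t) (X' i t)).
  by case: b; [under eq_fun do rewrite swapT; exact: mX|
    under eq_fun do rewrite swapF; exact: mX'].
have mle : measurable_fun setT (fun t =>
    zeta_hat sigma (X^~ t) (X'^~ t) (Y^~ t) (Z^~ t) <=
    zeta_hat_swap sigma pi (X^~ t) (X'^~ t) (Y^~ t) (Z^~ t)).
  apply: measurable_fun_ler; first exact: measurable_zeta_hat.
  exact: measurable_zeta_hat.
have -> : (fun t => (zeta_hat sigma (X^~ t) (X'^~ t) (Y^~ t) (Z^~ t) <=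
    zeta_hat_swap sigma pi (X^~ t) (X'^~ t) (Y^~ t) (Z^~ t))%R%:R) =
  (fun t => if zeta_hat sigma (X^~ t) (X'^~ t) (Y^~ t) (Z^~ t) <=
    zeta_hat_swap sigma pi (X^~ t) (X'^~ t) (Y^~ t) (Z^~ t) then 1 else 0 : R).
  by apply/funext => t; case: ifP.
exact: measurable_fun_ifT.
Qed.

End measurability.

Lemma Rintegral_distribution d (T : measurableType d)
    d' (S : measurableType d') (R : realType) (P : probability T R)
    (U : {mfun T >-> S}) (u : S -> R) (B : R) :
  measurable_fun setT u -> (forall s, `|u s| <= B) ->
  (\int[P]_t u (U t))%R = (\int[distribution P U]_s u s)%R.
Proof.
move=> mu uB; rewrite /Rintegral integral_pushforward//.
  exact/measurable_EFinP.
apply: (@integrable_bounded_fun _ _ _ P (u \o U) B); last by move=> t; exact: uB.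
exact: measurableT_comp.
Qed.

Lemma same_law_Rintegral d1 (T1 : measurableType d1) d2 (T2 : measurableType d2)
    d (S : measurableType d) (R : realType) (P1 : probability T1 R)
    (P2 : probability T2 R) (U1 : {mfun T1 >-> S}) (U2 : {mfun T2 >-> S})
    (u : S -> R) (B : R) :
  measurable_fun setT u -> (forall s, `|u s| <= B) ->
  (forall E, measurable E -> P1 (U1 @^-1` E) = P2 (U2 @^-1` E)) ->
  (\int[P1]_t u (U1 t))%R = (\int[P2]_t u (U2 t))%R.
Proof.
move=> mu uB U12; rewrite !(Rintegral_distribution _ _ mu uB)//.
by congr fine; apply: eq_measure_integral => E mE _; exact: U12.
Qed.

(** * A feature that separates the two laws *)

Section separation.
Context (R : realType) (dX dY dZ : nat).
Local Notation W := (obs R dX dY dZ * dX.-tuple R)%type.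

Definition original_vector (s : W) : (dX + dY + dZ).-tuple R :=
  obs_vector (xpart s.1) (ypart s.1) (zpart s.1).

Definition resampled_vector (s : W) : (dX + dY + dZ).-tuple R :=
  obs_vector s.2 (ypart s.1) (zpart s.1).

Lemma measurable_xpart : measurable_fun setT (@xpart R dX dY dZ).
Proof. by apply: (measurableT_comp measurable_fst); exact: measurable_fst. Qed.

Lemma measurable_ypart : measurable_fun setT (@ypart R dX dY dZ).
Proof. by apply: (measurableT_comp measurable_snd); exact: measurable_fst. Qed.

Lemma measurable_zpart : measurable_fun setT (@zpart R dX dY dZ).
Proof. exact: measurable_snd. Qed.

HB.instance Definition _ := isMeasurableFun.Build _ _ _ _ (@ypart R dX dY dZ)
  measurable_ypart.
HB.instance Definition _ := isMeasurableFun.Build _ _ _ _ (@zpart R dX dY dZ)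
  measurable_zpart.

Lemma measurable_original_vector : measurable_fun setT original_vector.
Proof.
by apply: measurable_obs_vector;
  [apply: (measurableT_comp measurable_xpart)
  |apply: (measurableT_comp measurable_ypart)
  |apply: (measurableT_comp measurable_zpart)]; exact: measurable_fst.
Qed.

Lemma measurable_resampled_vector : measurable_fun setT resampled_vector.
Proof.
by apply: measurable_obs_vector; [exact: measurable_snd
  |apply: (measurableT_comp measurable_ypart)
  |apply: (measurableT_comp measurable_zpart)]; exact: measurable_fst.
Qed.

HB.instance Definition _ := isMeasurableFun.Build _ _ _ _ original_vector
  measurable_original_vector.
HB.instance Definition _ := isMeasurableFun.Build _ _ _ _ resampled_vector
  measurable_resampled_vector.

Definition obs_box (A : set (dX.-tuple R)) (B : set (dY.-tuple R))
    (C : set (dZ.-tuple R)) : set ((dX + dY + dZ).-tuple R) :=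
  [set u | [/\ A [tuple tnth u (lshift dZ (lshift dY l)) | l < dX],
    B [tuple tnth u (lshift dZ (rshift dX l)) | l < dY] &
    C [tuple tnth u (rshift (dX + dY) l) | l < dZ]]].

Lemma obs_boxE A B C x y z : obs_box A B C (obs_vector x y z) <->
  [/\ A x, B y & C z].
Proof.
rewrite /obs_box/=; set a := (X in A X); set b := (X in B X); set e := (X in C X).
have -> : a = x by apply: eq_from_tnth => l; rewrite tnth_mktuple tnth_obs_vector_x.
have -> : b = y by apply: eq_from_tnth => l; rewrite tnth_mktuple tnth_obs_vector_y.
by have -> : e = z by apply: eq_from_tnth => l; rewrite tnth_mktuple tnth_obs_vector_z.
Qed.

Lemma measurable_obs_box A B C : measurable A -> measurable B -> measurable C ->
  measurable (obs_box A B C).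
Proof.
move=> mA mB mC.
have proj m (f : 'I_m -> 'I_(dX + dY + dZ)) (D : set (m.-tuple R)) :
    measurable D -> measurable
      ((fun u : (dX + dY + dZ).-tuple R => [tuple tnth u (f l) | l < m]) @^-1` D).
  move=> mD; rewrite -[X in measurable X]setTI.
  suff mf : measurable_fun setT (fun u : (dX + dY + dZ).-tuple R =>
      [tuple tnth u (f l) | l < m]) by exact: mf.
  apply/measurable_fun_tnthP => l.
  rewrite (_ : _ \o _ = (fun u => tnth u (f l))); first exact: measurable_tnth.
  by apply/funext => u /=; rewrite tnth_mktuple.
rewrite (_ : obs_box A B C =
    (fun u => [tuple tnth u (lshift dZ (lshift dY l)) | l < dX]) @^-1` A `&`
    ((fun u => [tuple tnth u (lshift dZ (rshift dX l)) | l < dY]) @^-1` B `&`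
     (fun u => [tuple tnth u (rshift (dX + dY) l) | l < dZ]) @^-1` C)).
  by apply: measurableI; [|apply: measurableI]; exact: proj.
by apply/seteqP; split => u /= => [[]|[? []]].
Qed.

Definition feature_difference (c : R) k (w : {ffun 'I_k -> 'I_(dX + dY + dZ)})
    (s : W) : R :=
  damped_monomial c w (original_vector s) -
  damped_monomial c w (resampled_vector s).

Lemma measurable_feature_difference c k (w : {ffun 'I_k -> 'I_(dX + dY + dZ)}) :
  measurable_fun setT (feature_difference c w).
Proof.
by apply: measurable_funB; apply: measurableT_comp => //;
  exact: measurable_damped_monomial.
Qed.

Lemma feature_difference_bounded c k (w : {ffun 'I_k -> 'I_(dX + dY + dZ)}) :
  0 < c -> exists B : R, forall s, `|feature_difference c w s| <= B.
Proof.
move=> /(damped_monomial_bounded w)[B wB]; exists (B + B) => s.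
by rewrite (le_trans (ler_normB _ _))// lerD.
Qed.

(** Otherwise the original and the resampled vectors have the same law, and
    comparing the two laws on boxes shows that the kernel remains the conditional
    distribution of [X] on every event that depends on [Y]. *)
Lemma exists_separating_word d (T : measurableType d) (Pr : probability T R)
    (P : probability (obs R dX dY dZ) R)
    (kappa : R.-pker (dZ.-tuple R) ~> (dX.-tuple R)) (n : nat)
    (V : 'I_n -> {RV Pr >-> obs R dX dY dZ})
    (X' : 'I_n -> {RV Pr >-> dX.-tuple R}) (i : 'I_n) (c : R) :
  iid P V -> drawn_given_sample kappa V X' ->
  is_cond_dist P (@xpart R dX dY dZ) (@zpart R dX dY dZ) kappa ->
  ~ cond_indep P (@xpart R dX dY dZ) (@ypart R dX dY dZ) (@zpart R dX dY dZ) ->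
  0 < c -> exists k (w : {ffun 'I_k -> 'I_(dX + dY + dZ)}),
    (\int[Pr]_t feature_difference c w (resampled V X' i t))%R != 0.
Proof.
move=> V_iid X'_drawn kappa_cond not_ci c0.
apply: contrapT => /forallNP no_w; apply: not_ci.
pose mu := distribution Pr (original_vector \o resampled V X' i).
pose nu := distribution Pr (resampled_vector \o resampled V X' i).
have munu : forall E, measurable E -> mu E = nu E.
  apply: (measure_eq_damped_monomials c0) => k w.
  have [B wB] := damped_monomial_bounded w c0.
  have mw := measurable_damped_monomial c w.
  rewrite -!(Rintegral_distribution _ _ mw wB).
  have int_w (U : {mfun T >-> (dX + dY + dZ).-tuple R}) :
      Pr.-integrable setT (EFin \o (damped_monomial c w \o U)).
    apply: (@integrable_bounded_fun _ _ _ Pr _ B); last by move=> t; exact: wB.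
    exact: measurableT_comp.
  apply/eqP; rewrite -subr_eq0 -RintegralB//; [|exact: int_w..].
  by apply/negPn/negP => h; apply: (no_w k); exists w.
apply: (cond_indep_of_kernel kappa_cond) => A B C mA mB mC.
have mXA : measurable (@xpart R dX dY dZ @^-1` A).
  by rewrite -[X in measurable X]setTI; exact: measurable_xpart.
have mYB : measurable (@ypart R dX dY dZ @^-1` B).
  by rewrite -[X in measurable X]setTI; exact: measurable_ypart.
have mZC : measurable (@zpart R dX dY dZ @^-1` C).
  by rewrite -[X in measurable X]setTI; exact: measurable_zpart.
have mYZ := measurableI _ _ mYB mZC.
rewrite -(resampled_law_rectE V_iid X'_drawn i mYZ mA).
have [_ Vlaw] := V_iid; rewrite -(Vlaw i); last exact: measurableI.
have := munu _ (measurable_obs_box mA mB mC).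
rewrite /mu /nu /distribution /pushforward.
rewrite [X in Pr X = _ -> _](_ : _ = V i @^-1`
    (@xpart R dX dY dZ @^-1` A `&` (@ypart R dX dY dZ @^-1` B `&`
     @zpart R dX dY dZ @^-1` C))).
  move=> ->; congr (Pr _).
  apply/seteqP; split => t /=.
    by move=> /obs_boxE[].
  by move=> [[? ?] ?]; apply/obs_boxE.
apply/seteqP; split => t /=.
  by move=> /obs_boxE[].
by move=> [? [? ?]]; apply/obs_boxE.
Qed.

End separation.

(** * Quantitative bounds *)

(** Write [S] for the pair kernel sum and [y = n c_w m^2]. Close to its mean the
    feature sum exceeds [n |m| / 2] in absolute value, so that
    [2 S + 2 n >= n y / 4]; as [y > 32] the diagonal is negligible and
    [S >= n y / 16]. Then [4 n^2 / S^2 <= 1024 / y^2 < alpha]. *)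
Lemma p_value_lt (R : realType) (dX dY dZ : nat) (sigma alpha m : R) (n k : nat)
    (X X' : 'I_n -> dX.-tuple R) (Y : 'I_n -> dY.-tuple R)
    (Z : 'I_n -> dZ.-tuple R) (w : {ffun 'I_k -> 'I_(dX + dY + dZ)}) g :
  g = damped_monomial (sigma ^+ 2 / 2) w ->
  0 < sigma ^+ 2 -> 0 < alpha < 1 -> (1 < n)%N ->
  32 / alpha < n%:R * ((sigma ^+ 2) ^+ k / k`!%:R * m ^+ 2) ->
  `|\sum_i (g (obs_vector (X i) (Y i) (Z i)) -
            g (obs_vector (X' i) (Y i) (Z i))) - n%:R * m| < n%:R * `|m| / 2 ->
  p_value sigma X X' Y Z < alpha.
Proof.
move=> gE s0 /andP[a0 a1] n1; set c := (_ ^+ k / _); set U := \sum_i _ => cn Um.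
have n0 : 0 < n%:R :> R by rewrite ltr0n (ltn_trans _ n1).
have c0 : 0 < c.
  by apply: divr_gt0; [exact: exprn_gt0|rewrite ltr0n fact_gt0].
have US : c * U ^+ 2 <= 2 * pair_kernel_sum sigma X X' Y Z + 2 * n%:R.
  exact: pair_kernel_sum_ge gE.
set S := pair_kernel_sum _ _ _ _ _ in US.
have Uge : (n%:R * `|m| / 2) ^+ 2 <= U ^+ 2.
  have h0 : 0 <= n%:R * `|m| / 2 by rewrite divr_ge0// mulr_ge0// ltW.
  rewrite -[leRHS]real_normK ?num_real// ler_sqr ?nnegrE//.
  have : n%:R * `|m| <= `|U| + `|U - n%:R * m|.
    have <- : `|n%:R * m| = n%:R * `|m| by rewrite normrM ger0_norm// ltW.
    by have := ler_normB U (U - n%:R * m); rewrite subKr.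
  by lra.
set y := n%:R * (c * m ^+ 2) in cn.
have y0 : 32 < y by apply: lt_trans cn; rewrite ltr_pdivlMr//; lra.
have Sy : n%:R * y / 16 <= S.
  have cU : n%:R * y / 4 <= c * U ^+ 2.
    rewrite (_ : n%:R * y / 4 = c * (n%:R * `|m| / 2) ^+ 2).
      by rewrite ler_wpM2l// ltW.
    by rewrite /y !exprMn real_normK ?num_real//; field.
  by nra.
have S0 : 0 < S.
  by apply: lt_le_trans Sy; rewrite divr_gt0// mulr_gt0//; lra.
apply: (le_lt_trans (p_value_le n1 S0)).
rewrite -/S ltr_pdivrMr ?exprn_gt0//.
apply: (@lt_le_trans _ _ (alpha * (n%:R * y / 16) ^+ 2)); last first.
  have h0 : 0 <= n%:R * y / 16 by rewrite divr_ge0// mulr_ge0//; lra.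
  rewrite ler_pM2l// ler_sqr ?nnegrE//; exact: ltW.
have ay : 32 < y * alpha by rewrite -ltr_pdivrMr.
rewrite (_ : alpha * _ = n%:R ^+ 2 * (y * alpha * y / 256)); last by field.
rewrite mulrC ltr_pM2l ?exprn_gt0//.
by nra.
Qed.

Section tail.
Context d (T : measurableType d) (R : realType) (Pr : probability T R)
  (dX dY dZ : nat) (P : probability (obs R dX dY dZ) R)
  (kappa : R.-pker (dZ.-tuple R) ~> (dX.-tuple R)) (n : nat)
  (V : 'I_n -> {RV Pr >-> obs R dX dY dZ})
  (X' : 'I_n -> {RV Pr >-> dX.-tuple R}).
Hypothesis V_iid : iid P V.
Hypothesis X'_drawn : drawn_given_sample kappa V X'.

Lemma resampled_sum_tail (u : obs R dX dY dZ * dX.-tuple R -> R) (B m : R) :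
  measurable_fun setT u -> (forall s, `|u s| <= B) -> m != 0 -> (0 < n)%N ->
  (forall i, (\int[Pr]_t u (resampled V X' i t))%R = m) ->
  (Pr [set t | (n%:R * `|m| / 2 <=
     `|\sum_i u (resampled V X' i t) - n%:R * m|)%R] <=
   (4 * (B + `|m|) ^+ 2 / m ^+ 2 / n%:R)%:E)%E.
Proof.
move=> mu uB m0 n0 um.
have n0' : 0 < n%:R :> R by rewrite ltr0n.
pose v s := u s - m.
have mv : measurable_fun setT v by exact: measurable_funB.
have vB s : `|v s| <= B + `|m| by rewrite (le_trans (ler_normB _ _))// lerD.
have v0 i : (\int[Pr]_t v (resampled V X' i t))%R = 0.
  rewrite RintegralB//.
  - by rewrite um Rintegral_cst// [X in fine X](probability_setT Pr) mulr1 subrr.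
  - apply: (@integrable_bounded_fun _ _ _ Pr (u \o resampled V X' i) B); last first.
      by move=> t; exact: uB.
    exact: measurableT_comp.
  - exact: (@integrable_bounded_fun _ _ _ Pr (cst m) `|m|).
have := @uncorrelated_sum_tail _ _ _ Pr n (fun i => v \o resampled V X' i)
  (B + `|m|) (n%:R * `|m| / 2).
have mvW i : measurable_fun setT (v \o resampled V X' i).
  exact: measurableT_comp.
move=> /(_ mvW).
move=> /(_ (fun i t => vB _)).
have e0 : 0 < n%:R * `|m| / 2 by rewrite divr_gt0// mulr_gt0// normr_gt0.
move=> /(_ _ e0); rewrite (_ : [set t | _] = [set t | (n%:R * `|m| / 2 <=
     `|\sum_i u (resampled V X' i t) - n%:R * m|)%R]); last first.
  apply/seteqP; split => t /=; rewrite /v sumrB sumr_const card_ord;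
    by rewrite -[m *+ n]mulr_natl.
move=> h; apply: le_trans (h _) _ => [i j ij|].
  rewrite (@independent_expectationM _ _ _ _ _ _ _ _ _ _ v v _ _
    (resampled_independent V_iid X'_drawn ij) mv vB mv vB).
  by rewrite !v0 mul0r.
rewrite lee_fin le_eqVlt; apply/orP; left; apply/eqP.
rewrite !exprMn real_normK ?num_real//; field.
by rewrite m0 gt_eqF.
Qed.

End tail.

(** * Consistency of the test *)

(** Both laws are given on rectangles by [P] and the kernel, so that the mean of a
    feature can be computed from a sample of size one. *)
Lemma resampled_same_law (R : realType) (dX dY dZ : nat)
    (P : probability (obs R dX dY dZ) R)
    (kappa : R.-pker (dZ.-tuple R) ~> (dX.-tuple R))
    d1 (T1 : measurableType d1) (P1 : probability T1 R) n1
    (V1 : 'I_n1 -> {RV P1 >-> obs R dX dY dZ})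
    (X1 : 'I_n1 -> {RV P1 >-> dX.-tuple R})
    d2 (T2 : measurableType d2) (P2 : probability T2 R) n2
    (V2 : 'I_n2 -> {RV P2 >-> obs R dX dY dZ})
    (X2 : 'I_n2 -> {RV P2 >-> dX.-tuple R}) i j E :
  iid P V1 -> drawn_given_sample kappa V1 X1 ->
  iid P V2 -> drawn_given_sample kappa V2 X2 -> measurable E ->
  P1 (resampled V1 X1 i @^-1` E) = P2 (resampled V2 X2 j @^-1` E).
Proof.
move=> V1_iid X1_drawn V2_iid X2_drawn.
apply: (measure_eq_rectangles (mu := distribution P1 (resampled V1 X1 i))
  (nu := distribution P2 (resampled V2 X2 j))) => [|B A mB mA].
  rewrite -ge0_fin_numE//.
  exact: (fin_num_measure (distribution P1 (resampled V1 X1 i))).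
exact: etrans (resampled_law_rectE V1_iid X1_drawn i mB mA)
  (esym (resampled_law_rectE V2_iid X2_drawn j mB mA)).
Qed.

Theorem proposition2p8 (R : realType) (dX dY dZ : nat)
    (P : probability (obs R dX dY dZ) R)
    (kappa : R.-pker (dZ.-tuple R) ~> (dX.-tuple R))
    (sigma : R) (sigma2_gt0 : 0 < sigma ^+ 2)
    (kappa_cond : is_cond_dist P (@xpart R dX dY dZ) (@zpart R dX dY dZ) kappa)
    (not_ci : ~ cond_indep P (@xpart R dX dY dZ) (@ypart R dX dY dZ)
                  (@zpart R dX dY dZ))
    (d : nat -> measure_display) (Omega : forall n, measurableType (d n))
    (Pr : forall n, probability (Omega n) R)
    (V : forall n, 'I_n -> {RV (Pr n) >-> obs R dX dY dZ})
    (X' : forall n, 'I_n -> {RV (Pr n) >-> dX.-tuple R})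
    (V_iid : forall n, iid P (V n))
    (X'_drawn : forall n, drawn_given_sample kappa (V n) (X' n))
    (alpha : R) (alpha01 : 0 < alpha < 1) :
  power sigma alpha (V n) (X' n) @[n --> \oo] --> 1%E.
Proof.
pose c := sigma ^+ 2 / 2.
have c0 : 0 < c by rewrite divr_gt0.
have [k [w]] := exists_separating_word ord0 (V_iid 1%N) (X'_drawn 1%N)
  kappa_cond not_ci c0.
pose u := feature_difference c w; rewrite -/u.
set m := (\int[_]_t _)%R => m0.
have mu : measurable_fun setT u := measurable_feature_difference c w.
have [B uB] := feature_difference_bounded w c0; rewrite -/u in uB.
have um n i : (\int[Pr n]_t u (resampled (V n) (X' n) i t))%R = m.
  by apply: (same_law_Rintegral mu uB) => E mE; exact: resampled_same_law mE.
pose K := (sigma ^+ 2) ^+ k / k`!%:R * m ^+ 2.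
have K0 : 0 < K.
  apply: mulr_gt0; last by rewrite exprn_even_gt0.
  by apply: divr_gt0; [exact: exprn_gt0|rewrite ltr0n fact_gt0].
pose C := 4 * (B + `|m|) ^+ 2 / m ^+ 2.
have mpower n : measurable [set t | p_value sigma (fun i => xpart (V n i t))
    (fun i => X' n i t) (fun i => ypart (V n i t)) (fun i => zpart (V n i t))
    < alpha].
  pose p t := p_value sigma (fun i => xpart (V n i t)) (fun i => X' n i t)
    (fun i => ypart (V n i t)) (fun i => zpart (V n i t)).
  suff mp : measurable_fun setT p.
    rewrite (_ : [set t | _] = setT `&` p @^-1` `]-oo, alpha[).
      exact: mp.
    by rewrite setTI; apply/seteqP; split => t /=; rewrite in_itv.
  apply: (@measurable_p_value _ _ _ sigma dX dY dZ n
    (fun i t => xpart (V n i t)) (X' n) (fun i t => ypart (V n i t))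
    (fun i t => zpart (V n i t))) => i //.
  - exact: (measurableT_comp (@measurable_xpart R dX dY dZ)).
  - exact: (measurableT_comp (@measurable_ypart R dX dY dZ)).
  - exact: (measurableT_comp (@measurable_zpart R dX dY dZ)).
have bound n : (1 < n)%N -> 32 / alpha / K < n%:R ->
    ((1 - C / n%:R)%:E <= power sigma alpha (V n) (X' n))%E.
  move=> n1 nK; have n0 : (0 < n)%N by exact: ltn_trans n1.
  have := resampled_sum_tail (V_iid n) (X'_drawn n) mu uB m0 n0 (um n).
  set D := [set t | _] => DC.
  have mD : measurable D.
    rewrite -[D]setTI; apply: measurable_fun_le => //.
    apply: measurableT_comp => //; apply: measurable_funB => //.
    by apply: measurable_sum => i; exact: measurableT_comp.
  rewrite /power; set G := [set t | _].
  have DG : ~` D `<=` G.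
    move=> t /negP; rewrite -ltNge => tD.
    apply: (p_value_lt (erefl _) sigma2_gt0 alpha01 n1 _ tD).
    by rewrite -/K -ltr_pdivrMr.
  apply: (@le_trans _ _ (Pr n (~` D))); last first.
    apply: le_measure => //; rewrite inE; first exact: measurableC.
    exact: mpower.
  rewrite probability_setC// EFinB; exact: leeB.
rewrite -cvg_shiftS.
have low : (1 - C * n.+1%:R^-1)%:E @[n --> \oo] --> 1%E.
  apply/fine_cvgP; split; first exact: nearW.
  rewrite -[X in _ --> X](subr0 1) -(mulr0 C).
  apply: cvgB; first exact: cvg_cst.
  by apply: cvgM; [exact: cvg_cst|exact: cvg_harmonic].
apply: (squeeze_cvge _ low (cvg_cst 1%E)); near=> n; apply/andP; split.
  apply: bound; first by rewrite ltnS; near: n; exact: nbhs_infty_gt.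
  apply: (@lt_trans _ _ n%:R); last by rewrite ltr_nat.
  by near: n; exact: nbhs_infty_gtr.
exact/probability_le1/mpower.
Unshelve. all: by end_near. Qed.
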